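(* Let $M$ be a finite $\mathcal J$-above $Y$-semigroup and let $\delta=2+2\sup\{h_{\mathcal J}(m):m\in M\}\in\overline{\mathbb N}$. Then there exist nonempty sets $X_i$ and an embedding (injective monoid homomorphism) $\varphi:\sigma\mapsto\varphi_\sigma$ of $\mathrm{Rh}_Y(M^I)$ into an iterated wreath product of partial transformation monoids $\prod_{i=1}^{\delta}(X_i,M_i)=\cdots\circ(X_2,M_2)\circ(X_1,M_1)$ such that: (i) $M_{2k+1}$ is a submonoid of $\{\mathrm{Id}_{X_{2k+1}}\}\cup K(X_{2k+1})$ for $2k+1\le\delta$; (ii) $M_{2k+2}$ is a submonoid of $S(X_{2k+2})\cup K(X_{2k+2})$ for $2k+2\le\delta$, and if $\{R_\lambda:\lambda\in\Lambda\}$ is the set of all $\mathcal R$-classes of $M^I$ contained in $U_2(k)\cup U_3(k)\cup U_4(k)$, then $M_{2k+2}\cap S(X_{2k+2})\cong\bigoplus_{\lambda\in\Lambda}G'_\lambda$ with each $G'_\lambda$ a subgroup of $G_\lambda$; (iii) $\varphi$ has the Zeiger property. Moreover, if $Y$ is finite, then all $X_i$ (hence all $M_i$) are finite.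
   Context: $M^I$: $M$ with a new identity $I$. Finite $\mathcal J$-above: $\{y:y\ge_{\mathcal J}x\}$ finite for all $x$. $h_{\mathcal J}(m)$: largest $k$ with a chain $m=m_0<_{\mathcal J}\cdots<_{\mathcal J}m_k$ in $M^I$. $Y$-semigroup: $M$ with a surjective morphism $Y^+\to M$. $\mathrm{Rh}(M^I)$: Rhodes expansion, chains $(m_k<_{\mathcal L}\cdots<_{\mathcal L}m_0=I)$ with product $\sigma\tau=\mathrm{lm}(m_kn\le_{\mathcal L}\cdots\le_{\mathcal L}m_1n\le_{\mathcal L}\tau)$, $n$ the leftmost term of $\tau$, $\mathrm{lm}$ keeping leftmost terms of $\mathcal L$-blocks; $\mathrm{Rh}_Y(M^I)$: submonoid generated by $(y<_{\mathcal L}I)$, $y\in Y$. For a set $X$: $P(X)$ partial self-maps, $S(X)$ permutations, $K(X)=\{\varphi\in P(X):|X\varphi|\le1\}$. Wreath product $\cdots\circ(X_2,M_2)\circ(X_1,M_1)$ ($M_i\le P(X_i)$): on $\mathcal X=\bigcup_{i\le\delta}X_i\times\cdots\times X_1$, the monoid of sequential partial maps ((SQ1) $(x_i,\dots,x_1)\in\mathrm{dom}\Rightarrow(x_{i-1},\dots,x_1)\in\mathrm{dom}$; (SQ2) preserves each $X_i\times\cdots\times X_1$; (SQ3) preserves equality of last $i$ components) whose local maps lie in the $M_i$; the local map $(\cdot,x_{i-1},\dots,x_1)\varphi\pi_i\in P(X_i)$ sends $x$ to the first component of $(x,x_{i-1},\dots,x_1)\varphi$ when defined. Zeiger property: for all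 $\sigma$, $k$ and $(x_{2k+1},\dots,x_1)$, if $(\cdot,x_{2k+1},\dots,x_1)\varphi_\sigma\pi_{2k+2}\in S(X_{2k+2})\setminus K(X_{2k+2})$, then for every $q$ with $2k+2\le q-1<\delta$ and every extension $(x_{q-1},\dots,x_{2k+2},x_{2k+1},\dots,x_1)$, the local map $(\cdot,x_{q-1},\dots,x_1)\varphi_\sigma\pi_q$ is a restriction of the identity of $X_q$. Further notation: $W(M^I)=\{m:\mathcal L_m=\mathcal H_m\}$; $G_m$ is the Schützenberger group of the $\mathcal H$-class of $m$ (same for all $m$ in an $\mathcal R$-class; $G_\lambda$ denotes it for $R_\lambda$); $q_m$ is the number of distinct $\mathcal L$-classes of elements $ym$ with $y\in Y$ and $ym<_{\mathcal L}m$. $U_2(k)=\{m\in W(M^I):h_{\mathcal J}(m)=k,\ |G_m|(1+q_m)>1\}$, $U_3(k)=\{m\notin W(M^I):h_{\mathcal J}(m)=k,\ |G_m|>1\}$, $U_4(k)=\{m\notin W(M^I):h_{\mathcal J}(m)=k,\ |G_m|\cdot q_m>1\}$. *)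

(* Defs.v *)
From Stdlib Require Import List Arith ClassicalEpsilon.
Import ListNotations.

Record semigroup := Semigroup {
  car : Type;
  smul : car -> car -> car;
  sassoc : forall a b c, smul a (smul b c) = smul (smul a b) c }.

Definition finite_type (T : Type) : Prop := exists l : list T, forall x, In x l.

Section Green.
Variable Sg : semigroup.

Definition MI := option (car Sg).
Definition I_ : MI := None.
Definition mulI (a b : MI) : MI :=
  match a, b with
  | None, _ => b
  | _, None => a
  | Some x, Some y => Some (smul Sg x y)
  end.

Definition Lle (a b : MI) : Prop := exists c, a = mulI c b.
Definition Rle (a b : MI) : Prop := exists c, a = mulI b c.
Definition Jle (a b : MI) : Prop := exists c d, a = mulI (mulI c b) d.
Definition Leq a b := Lle a b /\ Lle b a.
Definition Req a b := Rle a b /\ Rle b a.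
Definition Heq a b := Leq a b /\ Req a b.
Definition Llt a b := Lle a b /\ ~ Lle b a.
Definition Jlt a b := Jle a b /\ ~ Jle b a.

Definition finite_J_above : Prop :=
  forall x : car Sg, exists l : list (car Sg),
    forall y : car Sg, Jle (Some x) (Some y) -> In y l.

Definition J_chain (m : MI) (k : nat) (c : nat -> MI) : Prop :=
  c 0 = m /\ forall j, j < k -> Jlt (c j) (c (S j)).
Definition is_hJ (m : MI) (k : nat) : Prop :=
  (exists c, J_chain m k c) /\ (forall k' c, J_chain m k' c -> k' <= k).

(* A chain (m_k <_L ... <_L m_1 <_L m_0 = I) is the list [m_k; ...; m_1; m_0]. *)
Fixpoint Lchain (l : list MI) : Prop :=
  match l with
  | [] => False
  | [a] => a = I_
  | a :: ((b :: _) as l') => Llt a b /\ Lchain l'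
  end.

Definition Leqb (a b : MI) : bool :=
  if excluded_middle_informative (Leq a b) then true else false.

Fixpoint lm (l : list MI) : list MI :=
  match l with
  | [] => []
  | a :: l' =>
      match lm l' with
      | [] => [a]
      | b :: l'' => if Leqb a b then a :: l'' else a :: b :: l''
      end
  end.

Definition rh_mul (sigma tau : list MI) : list MI :=
  let n := hd I_ tau in
  lm (map (fun x => mulI x n) (removelast sigma) ++ tau).

Definition rh_one : list MI := [I_].

Section Y.
Variables (Y : Type) (iota : Y -> car Sg).

Definition word_eval (y : Y) (ys : list Y) : car Sg :=
  fold_left (fun a b => smul Sg a (iota b)) ys (iota y).
Definition Y_generates : Prop :=
  forall m : car Sg, exists y ys, m = word_eval y ys.

Inductive inRhY : list MI -> Prop :=
  | RhY_one : inRhY rh_one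
  | RhY_gen : forall y, inRhY [Some (iota y); I_]
  | RhY_mul : forall s t, inRhY s -> inRhY t -> inRhY (rh_mul s t).

Definition inW (m : MI) : Prop := forall x, Leq x m -> Heq x m.

Definition Rclass (m : MI) : MI -> Prop := fun x => Req x m.
Definition is_Rclass (lam : MI -> Prop) : Prop :=
  exists m, forall x, lam x <-> Req x m.

(* Schutzenberger group G_lam of the R-class lam: the permutations induced
   by left multiplications by s in M^I with s H_m ⊆ H_m (m in lam); they are
   recorded through their action on the whole R-class lam (identity outside). *)
Definition GR (lam : MI -> Prop) (g : MI -> MI) : Prop :=
  exists m, lam m /\ exists s : MI,
    (forall h, Heq h m -> Heq (mulI s h) m) /\
    (forall x, lam x -> g x = mulI s x) /\
    (forall x, ~ lam x -> g x = x).

Definition G_nontriv (m : MI) : Prop :=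
  exists g g', GR (Rclass m) g /\ GR (Rclass m) g' /\ g <> g'.

Definition q_ge1 (m : MI) : Prop :=
  exists y, Llt (mulI (Some (iota y)) m) m.
Definition q_ge2 (m : MI) : Prop :=
  exists y y', Llt (mulI (Some (iota y)) m) m /\ Llt (mulI (Some (iota y')) m) m /\
    ~ Leq (mulI (Some (iota y)) m) (mulI (Some (iota y')) m).

Definition U2 (k : nat) (m : MI) : Prop :=
  inW m /\ is_hJ m k /\ (G_nontriv m \/ q_ge1 m).          (* |G_m|(1+q_m) > 1 *)
Definition U3 (k : nat) (m : MI) : Prop :=
  ~ inW m /\ is_hJ m k /\ G_nontriv m.
Definition U4 (k : nat) (m : MI) : Prop :=
  ~ inW m /\ is_hJ m k /\ ((G_nontriv m /\ q_ge1 m) \/ q_ge2 m). (* |G_m| q_m > 1 *)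

Definition Lambda (k : nat) (lam : MI -> Prop) : Prop :=
  is_Rclass lam /\ forall x, lam x -> U2 k x \/ U3 k x \/ U4 k x.

End Y.

(* i <= delta where delta = 2 + 2 sup{h_J(m) : m in M} in N ∪ {oo} *)
Definition le_delta (i : nat) : Prop :=
  i <= 2 \/ exists (m : car Sg) (h : nat), is_hJ (Some m) h /\ i <= 2 + 2 * h.
Definition in_range (i : nat) : Prop := 1 <= i /\ le_delta i.

End Green.

Section Partial.
Variable T : Type.
Definition pcomp (f g : T -> option T) : T -> option T :=
  fun x => match f x with Some y => g y | None => None end.
Definition pid : T -> option T := fun x => Some x.
Definition isPerm (f : T -> option T) : Prop :=
  (forall x, exists y, f x = Some y) /\
  (forall x x' y, f x = Some y -> f x' = Some y -> x = x') /\
  (forall y, exists x, f x = Some y).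
Definition isK (f : T -> option T) : Prop :=
  forall x x' y y', f x = Some y -> f x' = Some y' -> y = y'.
Definition restr_id (f : T -> option T) : Prop :=
  forall x y, f x = Some y -> y = x.
Definition submonoidP (Mn : (T -> option T) -> Prop) : Prop :=
  Mn pid /\ forall f g, Mn f -> Mn g -> Mn (pcomp f g).
End Partial.

Section Wreath.
Variable X : nat -> Type.

Fixpoint tup (i : nat) : Type :=
  match i with 0 => unit | S k => (X (S k) * tup k)%type end.

Fixpoint drop (n : nat) : forall i, tup (n + i) -> tup i :=
  match n with
  | 0 => fun i t => t
  | S n' => fun i t => drop n' i (snd t)
  end.

(* a level-preserving partial map of the union of the tup i (SQ2 built in) *)
Definition seqmap := forall i, tup i -> option (tup i).

Definition sq_comp (f g : seqmap) : seqmap := fun i t =>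
  match f i t with Some u => g i u | None => None end.

Definition loc (f : seqmap) (p : nat) (t : tup p) : X (S p) -> option (X (S p)) :=
  fun x => match f (S p) ((x, t) : tup (S p)) with
           | Some u => Some (fst u) | None => None end.

Variable inr : nat -> Prop.   (* the levels 1 <= i <= delta *)
Variable Mi : forall i, (X i -> option (X i)) -> Prop.

Definition in_wreath (f : seqmap) : Prop :=
  (forall p (x : X (S p)) (t : tup p), 1 <= p -> inr (S p) ->
      f (S p) ((x, t) : tup (S p)) <> None -> f p t <> None) /\
  (forall j n n' (t : tup (n + j)) (t' : tup (n' + j)) u u',
      inr (n + j) -> inr (n' + j) ->
      drop n j t = drop n' j t' ->
      f (n + j) t = Some u -> f (n' + j) t' = Some u' ->
      drop n j u = drop n' j u') /\
  (forall p (t : tup p), inr (S p) -> Mi (S p) (loc f p t)).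

End Wreath.

Section Groups.
Variable Sg : semigroup.

Definition is_subgroup (lam : MI Sg -> Prop) (P : (MI Sg -> MI Sg) -> Prop) : Prop :=
  (forall g, P g -> GR Sg lam g) /\
  P (fun x => x) /\
  (forall g g', P g -> P g' -> P (fun x => g (g' x))) /\
  (forall g, P g -> exists g', P g' /\ forall x, g (g' x) = x).

Definition in_dsum (Lam : (MI Sg -> Prop) -> Prop)
    (G' : (MI Sg -> Prop) -> (MI Sg -> MI Sg) -> Prop)
    (F : (MI Sg -> Prop) -> MI Sg -> MI Sg) : Prop :=
  (forall lam, Lam lam -> G' lam (F lam)) /\
  (forall lam, ~ Lam lam -> F lam = (fun x => x)) /\
  (exists l : list (MI Sg -> Prop), forall lam, F lam <> (fun x => x) -> In lam l).

Definition dsum_iso (T : Type) (N : (T -> option T) -> Prop)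
    (D : ((MI Sg -> Prop) -> MI Sg -> MI Sg) -> Prop)
    (psi : (T -> option T) -> (MI Sg -> Prop) -> MI Sg -> MI Sg) : Prop :=
  (forall f, N f -> D (psi f)) /\
  (forall f f', N f -> N f' -> psi f = psi f' -> f = f') /\
  (forall F, D F -> exists f, N f /\ psi f = F) /\
  (forall f g, N f -> N g ->
     psi (pcomp T f g) = (fun lam x => psi f lam (psi g lam x))).
End Groups.

(* Main.v *)
(* A chain (m_k <_L ... <_L m_0 = I) has at most one entry of each J-height.  Let
   r_a = a u_a be a chosen representative of the R-class of a.  An entry m with
   predecessor a, so m = z a, is recorded as m u_a = z r_a, first by its L-class
   (odd levels), then by its position in this L-class, translated to the H-class
   of the representative of the R-class of m (even levels).  Let tau act on the
   right with leftmost term n.  If m n is R-equivalent to m then so is m' n to m'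
   for every deeper entry m', and z a n u_(an) = z r_(an) = z r_a, so that all
   deeper coordinates are fixed; the even coordinate of m itself moves by a right
   translation inside each H-class, i.e. by an element of the direct sum of the
   Schutzenberger groups.  If m n drops in the J-order, the new value of the
   coordinate no longer depends on the old one, and the local map is constant. *)

Require Import Defs.
From Stdlib Require Import List Arith Lia Bool.
From Stdlib Require Import Classical ClassicalEpsilon FunctionalExtensionality PropExtensionality.
Import ListNotations.

(** In a wreath product the local map at level i + 1 may depend only on the i coordinates before it,
    and this dictates what is recorded where. The L-class of the entry following a is stored right
    after a, whatever the height of that entry: up to translation it is the L-class of some y r_a,
    so a finite [Y] leaves finitely many values, and the even level of an entry m knows the L-class
    of m before it moves m inside it. Whether m n drops depends only on that L-class; if it drops, m
    n has left height k, so the entry of height k in the product is computed from what is already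
    known. A permutation must also act on values unrelated to the L-class of m, so the translation
    is extended by the identity to the other R-classes of height k. Only finitely many R-classes
    meet one L-class, all elements of which are J-above a fixed one: hence a direct sum and not a
    direct product. The same finiteness gives stability, so that a n is R-equivalent to a exactly
    when the heights agree, and most arguments become comparisons of heights. *)

Section Holonomy.
Variable Sg : semigroup.
Variables (Y : Type) (iota : Y -> car Sg).
Hypothesis HY : Y_generates Sg Y iota.
Hypothesis HJ : finite_J_above Sg.

Local Notation N := (MI Sg).
Local Notation I := (I_ Sg).
Local Notation "a ** b" := (mulI Sg a b) (at level 40, left associativity).
Local Notation "a <=L b" := (Lle Sg a b) (at level 70).
Local Notation "a <=R b" := (Rle Sg a b) (at level 70).
Local Notation "a <=J b" := (Jle Sg a b) (at level 70).
Local Notation "a ~L b" := (Leq Sg a b) (at level 70).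
Local Notation "a ~R b" := (Req Sg a b) (at level 70).
Local Notation "a ~H b" := (Heq Sg a b) (at level 70).
Local Notation dec := excluded_middle_informative.

(** * Green's relations and the height function *)

Lemma mulIA (a b c : N) : a ** (b ** c) = a ** b ** c.
Proof. destruct a, b, c; simpl; try reflexivity. now rewrite sassoc. Qed.

Lemma mulI1 (a : N) : a ** I = a.
Proof. now destruct a. Qed.

Lemma mulI_eq1 (a b : N) : a ** b = I -> a = I /\ b = I.
Proof. unfold I_; destruct a, b; simpl; intuition congruence. Qed.

Lemma Lle_refl (a : N) : a <=L a.
Proof. now exists I. Qed.

Lemma Rle_refl (a : N) : a <=R a.
Proof. exists I. now rewrite mulI1. Qed.

Lemma Lle_trans (a b c : N) : a <=L b -> b <=L c -> a <=L c.
Proof. intros [x ->] [y ->]. exists (x ** y). now rewrite mulIA. Qed.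

Lemma Rle_trans (a b c : N) : a <=R b -> b <=R c -> a <=R c.
Proof. intros [x ->] [y ->]. exists (y ** x). now rewrite mulIA. Qed.

Lemma Jle_trans (a b c : N) : a <=J b -> b <=J c -> a <=J c.
Proof.
  intros [x [x' ->]] [y [y' ->]]. exists (x ** y), (y' ** x'). now rewrite !mulIA.
Qed.

Lemma Lle_mulr (a b c : N) : a <=L b -> a ** c <=L b ** c.
Proof. intros [x ->]. exists x. now rewrite mulIA. Qed.

Lemma Lle_Jle (a b : N) : a <=L b -> a <=J b.
Proof. intros [x ->]. exists x, I. now rewrite mulI1. Qed.

Lemma Rle_Jle (a b : N) : a <=R b -> a <=J b.
Proof. intros [x ->]. now exists I, x. Qed.

Lemma Leq_refl (a : N) : a ~L a.
Proof. split; apply Lle_refl. Qed.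

Lemma Req_refl (a : N) : a ~R a.
Proof. split; apply Rle_refl. Qed.

Lemma Leq_sym (a b : N) : a ~L b -> b ~L a.
Proof. intros []; now split. Qed.

Lemma Req_sym (a b : N) : a ~R b -> b ~R a.
Proof. intros []; now split. Qed.

Lemma Leq_trans (a b c : N) : a ~L b -> b ~L c -> a ~L c.
Proof. intros [] []; split; eapply Lle_trans; eassumption. Qed.

Lemma Req_trans (a b c : N) : a ~R b -> b ~R c -> a ~R c.
Proof. intros [] []; split; eapply Rle_trans; eassumption. Qed.

Lemma Leq_mulr (a b c : N) : a ~L b -> a ** c ~L b ** c.
Proof. intros []; split; now apply Lle_mulr. Qed.

Lemma Heq_refl (a : N) : a ~H a.
Proof. split; [apply Leq_refl | apply Req_refl]. Qed.

Lemma Heq_sym (a b : N) : a ~H b -> b ~H a.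
Proof. intros []; split; [now apply Leq_sym | now apply Req_sym]. Qed.

Lemma Heq_trans (a b c : N) : a ~H b -> b ~H c -> a ~H c.
Proof.
  intros [] []; split; [eapply Leq_trans | eapply Req_trans]; eassumption.
Qed.

Lemma Req_mulr (a n : N) : (exists n', a ** n ** n' = a) -> a ** n ~R a.
Proof. intros [n' E]. split; [now exists n | now exists n']. Qed.

Lemma Req_mulr_inv (a n : N) : a ** n ~R a -> exists n', a ** n ** n' = a.
Proof. intros [_ [n' E]]. now exists n'. Qed.

Lemma Req_mulr_L (a b n : N) : b <=L a -> a ** n ~R a -> b ** n ~R b.
Proof.
  intros [z ->] [n' E]%Req_mulr_inv. apply Req_mulr. exists n'.
  rewrite <- !mulIA. f_equal. now rewrite !mulIA.
Qed.

Lemma pigeon_list {T : Type} (l : list T) (f : nat -> T) :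
  (forall i, In (f i) l) -> exists i j, i < j /\ f i = f j.
Proof.
  intro Hin. apply NNPP. intro Hno.
  assert (Hnd : forall s m, NoDup (map f (seq s m))).
  { intros s m. revert s. induction m as [|m IH]; intro s; simpl; constructor; auto.
    rewrite in_map_iff. intros [j [E Hj]]. apply in_seq in Hj.
    apply Hno. exists s, j. split; [lia | congruence]. }
  assert (Hincl : incl (map f (seq 0 (S (length l)))) l).
  { intros x [i [<- _]]%in_map_iff. apply Hin. }
  apply NoDup_incl_length in Hincl; [|apply Hnd].
  rewrite length_map, length_seq in Hincl. lia.
Qed.

Lemma J_above_list (m : N) : exists l : list N, forall x, m <=J x -> In x l.
Proof.
  destruct m as [m|].
  - destruct (HJ m) as [l Hl]. exists (None :: map Some l). intros [x|] Hx; [right|now left].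
    apply in_map. now apply Hl.
  - exists [None]. intros x [c [d E]]. left. symmetry in E.
    apply mulI_eq1 in E as [E _]. now apply mulI_eq1 in E.
Qed.

Lemma iter_mull (g b : N) (d : nat) :
  exists w, forall z, Nat.iter d (mulI Sg g) (b ** z) = w ** b ** z.
Proof.
  induction d as [|d [w IH]]; simpl.
  - now exists I.
  - exists (g ** w). intro z. rewrite IH. now rewrite !mulIA.
Qed.

Lemma iter_mulr (g q b : N) (d : nat) :
  Nat.iter d (mulI Sg g) b ** q = Nat.iter d (mulI Sg g) (b ** q).
Proof. induction d as [|d IH]; simpl; [reflexivity|]. now rewrite <- mulIA, IH. Qed.

Lemma iter_mulr_l (g q b : N) (d : nat) :
  q ** Nat.iter d (fun z => z ** g) b = Nat.iter d (fun z => z ** g) (q ** b).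
Proof. induction d as [|d IH]; simpl; [reflexivity|]. now rewrite mulIA, IH. Qed.

(** Stability. From b = p c b q, every (p c)^i b is J-above b, so two of these elements coincide;
    multiplying by a power of q gives b = (p c)^d b with d > 0, a left multiple of c b. *)
Lemma L_stable (a b : N) : a <=L b -> b <=J a -> a ~L b.
Proof.
  intros [c ->] [p [q E]]. split; [now exists c|].
  set (f := fun i => Nat.iter i (mulI Sg (p ** c)) b).
  assert (Hz : forall i, exists z, b = f i ** z).
  { induction i as [|i [z Hz]].
    - exists I. unfold f; simpl. now rewrite mulI1.
    - exists (z ** q). unfold f in *; simpl.
      rewrite E at 1. rewrite Hz at 1. now rewrite !mulIA. }
  destruct (J_above_list b) as [l Hl].
  destruct (pigeon_list l f) as [i [j [Hij Ef]]].
  { intro i. apply Hl. destruct (Hz i) as [z Hb]. now exists I, z. }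
  destruct (Hz i) as [z Hb].
  assert (Ej : f j = Nat.iter (j - i) (mulI Sg (p ** c)) (f i)).
  { unfold f. rewrite <- Nat.iter_add. f_equal. lia. }
  assert (Eb : b = Nat.iter (j - i) (mulI Sg (p ** c)) b).
  { rewrite Hb at 1. rewrite Ef, Ej, iter_mulr. now rewrite <- Hb. }
  destruct (j - i) as [|d] eqn:Ed; [lia|].
  rewrite Nat.iter_succ_r in Eb.
  destruct (iter_mull (p ** c) (p ** c ** b) d) as [w Hw].
  specialize (Hw I). rewrite !mulI1 in Hw. rewrite Hw in Eb.
  exists (w ** p). rewrite Eb at 1. now rewrite !mulIA.
Qed.

Lemma R_stable (a b : N) : a <=R b -> b <=J a -> a ~R b.
Proof.
  intros [c ->] [p [q E]]. split; [now exists c|].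
  set (f := fun i => Nat.iter i (fun z => z ** (c ** q)) b).
  assert (Hz : forall i, exists z, b = z ** f i).
  { induction i as [|i [z Hz]].
    - now exists I.
    - exists (p ** z). unfold f in *; simpl.
      rewrite E at 1. rewrite Hz at 1. now rewrite !mulIA. }
  destruct (J_above_list b) as [l Hl].
  destruct (pigeon_list l f) as [i [j [Hij Ef]]].
  { intro i. apply Hl. destruct (Hz i) as [z Hb]. exists z, I. now rewrite mulI1. }
  destruct (Hz i) as [z Hb].
  assert (Ej : f j = Nat.iter (j - i) (fun z => z ** (c ** q)) (f i)).
  { unfold f. rewrite <- Nat.iter_add. f_equal. lia. }
  assert (Eb : b = Nat.iter (j - i) (fun z => z ** (c ** q)) b).
  { rewrite Hb at 1. rewrite Ef, Ej, iter_mulr_l. now rewrite <- Hb. }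
  destruct (j - i) as [|d] eqn:Ed; [lia|].
  rewrite Nat.iter_succ_r in Eb.
  assert (Hw : forall e, exists w, Nat.iter e (fun z => z ** (c ** q)) (b ** (c ** q)) = b ** c ** w).
  { induction e as [|e [w IH]]; simpl.
    - exists q. now rewrite !mulIA.
    - exists (w ** c ** q). rewrite IH. now rewrite !mulIA. }
  destruct (Hw d) as [w Ew]. exists w. now rewrite <- Ew.
Qed.

Lemma J_chain_lt (m : N) (k : nat) (c : nat -> N) (i j : nat) :
  J_chain Sg m k c -> i < j -> j <= k -> Jlt Sg (c i) (c j).
Proof.
  intros [_ Hc] Hij. induction Hij as [|j Hij IH]; intro Hj; [apply Hc; lia|].
  destruct IH as [A B]; [lia|]. destruct (Hc j) as [A' B']; [lia|].
  split; [eapply Jle_trans; eassumption|].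
  intro F. apply B'. eapply Jle_trans; [exact F | exact A].
Qed.

(** The terms of a strict J-chain from m are distinct and lie in the finite set J-above m. *)
Lemma J_chain_bound (m : N) : exists B, forall k c, J_chain Sg m k c -> k <= B.
Proof.
  destruct (J_above_list m) as [l Hl]. exists (length l). intros k c Hc.
  assert (Hnd : forall s n, s + n <= S k -> NoDup (map c (seq s n))).
  { intros s n. revert s. induction n as [|n IH]; intros s Hs; simpl; constructor.
    - rewrite in_map_iff. intros [j [E Hj]]. apply in_seq in Hj.
      destruct (J_chain_lt m k c s j Hc) as [A B]; [lia|lia|].
      apply B. rewrite E. exists I, I. now rewrite mulI1.
    - apply IH. lia. }
  assert (Hincl : incl (map c (seq 0 (S k))) l).
  { intros x [i [<- Hi]]%in_map_iff. apply in_seq in Hi. apply Hl.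
    rewrite <- (proj1 Hc). destruct i as [|i].
    - exists I, I. now rewrite mulI1.
    - apply (J_chain_lt m k c 0 (S i) Hc); lia. }
  apply NoDup_incl_length in Hincl; [|apply Hnd; lia].
  rewrite length_map, length_seq in Hincl. lia.
Qed.

Lemma is_hJ_ex (m : N) : exists k, is_hJ Sg m k.
Proof.
  destruct (J_chain_bound m) as [B HB].
  assert (H : forall d k, B - k <= d -> (exists c, J_chain Sg m k c) ->
            exists k', is_hJ Sg m k').
  { induction d as [|d IH]; intros k Hk Hc;
    destruct (classic (exists k' c, J_chain Sg m k' c /\ k < k')) as [[k' [c [Hc' Hlt]]]|Hno].
    - apply HB in Hc'. lia.
    - exists k. split; [exact Hc|]. intros k' c Hc'.
      destruct (le_lt_dec k' k) as [L|L]; [exact L|]. exfalso; eauto.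
    - apply (IH k'); [|now exists c]. apply HB in Hc'. lia.
    - exists k. split; [exact Hc|]. intros k' c Hc'.
      destruct (le_lt_dec k' k) as [L|L]; [exact L|]. exfalso; eauto. }
  apply (H (B - 0) 0); [lia|]. exists (fun _ => m). split; [reflexivity|]. intros; lia.
Qed.

Definition hJ (m : N) : nat := epsilon (inhabits 0) (is_hJ Sg m).

Lemma hJP (m : N) : is_hJ Sg m (hJ m).
Proof. unfold hJ. apply epsilon_spec, is_hJ_ex. Qed.

Lemma is_hJ_hJ (m : N) (k : nat) : is_hJ Sg m k -> hJ m = k.
Proof.
  intros [[c Hc] Hk]. destruct (hJP m) as [[c' Hc'] Hm].
  apply Hk in Hc'. apply Hm in Hc. lia.
Qed.

Lemma hJ_lt (a b : N) : Jlt Sg a b -> hJ b < hJ a.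
Proof.
  intro Hab. destruct (hJP b) as [[c [E Hc]] _]. destruct (hJP a) as [_ Ha].
  apply (Ha (S (hJ b)) (fun i => match i with 0 => a | S i => c i end)).
  split; [reflexivity|]. intros [|j] Hj; [now rewrite E|]. apply Hc. lia.
Qed.

Lemma hJ_le (a b : N) : a <=J b -> hJ b <= hJ a.
Proof.
  intro Hab. destruct (hJP b) as [[c [E Hc]] _]. destruct (hJP a) as [_ Ha].
  apply (Ha (hJ b) (fun i => match i with 0 => a | S i => c (S i) end)).
  split; [reflexivity|]. intros [|j] Hj; [|now apply Hc].
  destruct (Hc 0) as [A B]; [lia|]. rewrite E in A, B.
  split; [eapply Jle_trans; eassumption|].
  intro F. apply B. eapply Jle_trans; eassumption.
Qed.

Lemma hJ_Jle_sym (a b : N) : a <=J b -> hJ a = hJ b -> b <=J a.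
Proof.
  intros Hab E. apply NNPP. intro F.
  assert (hJ b < hJ a) by (apply hJ_lt; now split). lia.
Qed.

(** Stability in numerical form; later tests for R-equivalence are decided by comparing heights
    through it. *)
Lemma hJ_Req (a b : N) : a <=R b -> hJ a = hJ b -> a ~R b.
Proof.
  intros H E. apply R_stable; [exact H|].
  apply hJ_Jle_sym; [now apply Rle_Jle | exact E].
Qed.

Lemma Leq_hJ (a b : N) : a ~L b -> hJ a = hJ b.
Proof.
  intros [A B]. apply Nat.le_antisymm; apply hJ_le; now apply Lle_Jle.
Qed.

Lemma Req_hJ (a b : N) : a ~R b -> hJ a = hJ b.
Proof.
  intros [A B]. apply Nat.le_antisymm; apply hJ_le; now apply Rle_Jle.
Qed.

Lemma hJ_Lle (a b : N) : a <=L b -> hJ b <= hJ a.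
Proof. intro H. now apply hJ_le, Lle_Jle. Qed.

Lemma hJ_mulr (a n : N) : hJ a <= hJ (a ** n).
Proof. apply hJ_le, Rle_Jle. now exists n. Qed.

Lemma hJ_mulr_R (a n : N) : a ** n ~R a <-> hJ (a ** n) = hJ a.
Proof.
  split; [apply Req_hJ|]. apply hJ_Req. now exists n.
Qed.

Lemma hJ_I : hJ I = 0.
Proof.
  apply is_hJ_hJ. split; [exists (fun _ => I); split; [reflexivity|intros; lia]|].
  intros [|k] c [E Hc]; [lia|]. destruct (Hc 0) as [[p [q A]] B]; [lia|].
  rewrite E in A. symmetry in A. apply mulI_eq1 in A as [A _].
  apply mulI_eq1 in A as [_ A]. exfalso. apply B. rewrite E, A. exists I, I. reflexivity.
Qed.

Lemma hJ_eq0 (m : N) : hJ m = 0 -> m = I.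
Proof.
  intro E. destruct m as [x|]; [|reflexivity].
  assert (H : hJ I < hJ (Some x)); [|lia].
  apply hJ_lt. split; [exists (Some x), I; now rewrite mulI1|].
  intros [p [q A]]. symmetry in A. apply mulI_eq1 in A as [A _].
  apply mulI_eq1 in A as [_ A]. discriminate A.
Qed.

(** * Finiteness of the set of elements of bounded height *)

Definition finite_pred (P : N -> Prop) : Prop := exists l : list N, forall x, P x -> In x l.

Lemma finite_J_up (l : list N) : finite_pred (fun x => exists p, In p l /\ p <=J x).
Proof.
  induction l as [|a l [l' IH]].
  - exists []. now intros x [p [[] _]].
  - destruct (J_above_list a) as [la Ha]. exists (la ++ l').
    intros x [p [[<-|Hp] Hx]]; apply in_or_app; [left; auto | right; eauto].
Qed.

(** The first prefix of height more than k is R-above m, so its height is squeezed between k + 1 and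
    that of m. Equal heights then make it J-equivalent to m. *)
Lemma word_crosses_level (k : nat) (ys : list Y) (p : N) :
  hJ p <= k ->
  let m := fold_left (fun a b => a ** Some (iota b)) ys p in
  hJ m = S k -> exists p' y, hJ p' <= k /\ p' ** Some (iota y) <=J m.
Proof.
  revert p. induction ys as [|y ys IH]; intros p Hp m Hm; simpl in m.
  - subst m. lia.
  - destruct (le_lt_dec (hJ (p ** Some (iota y))) k) as [L|L].
    + now apply (IH (p ** Some (iota y))).
    + exists p, y. split; [exact Hp|].
      assert (Hle : m <=R p ** Some (iota y)).
      { subst m. clear. generalize (p ** Some (iota y)). induction ys as [|z ys IH]; intro q; simpl.
        - apply Rle_refl.
        - eapply Rle_trans; [apply IH|]. now exists (Some (iota z)). }
      apply Rle_Jle in Hle. apply hJ_Jle_sym; [exact Hle|].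
      apply hJ_le in Hle. lia.
Qed.

Lemma word_eval_fold (y : Y) (ys : list Y) :
  Some (word_eval Sg Y iota y ys) = fold_left (fun a b => a ** Some (iota b)) (y :: ys) I.
Proof.
  unfold word_eval; simpl. generalize (iota y).
  induction ys as [|z ys IH]; intro a; simpl; [reflexivity|]. apply IH.
Qed.

(** Each element of height k + 1 is J-above one of the finitely many p y with p of height at most
    k. *)
Lemma finite_level (k : nat) : finite_type Y -> finite_pred (fun m => hJ m <= k).
Proof.
  intros [lY HlY]. induction k as [|k [l IH]].
  - exists [I]. intros m Hm. left. symmetry. apply hJ_eq0. lia.
  - destruct (finite_J_up (flat_map (fun p => map (fun y => p ** Some (iota y)) lY) l))
      as [l' Hl'].
    exists (l ++ l'). intros m Hm. apply in_or_app.
    destruct (le_lt_dec (hJ m) k) as [L|L]; [left; auto|right]. apply Hl'.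
    destruct m as [m|]; [|pose proof hJ_I; unfold I_ in *; lia].
    destruct (HY m) as [y [ys E]]. subst m.
    rewrite word_eval_fold in L, Hm |- *.
    destruct (word_crosses_level k (y :: ys) I) as [p [z [Hp Hz]]].
    + rewrite hJ_I. lia.
    + lia.
    + exists (p ** Some (iota z)). split; [|exact Hz].
      apply in_flat_map. exists p. split; [now apply IH|]. apply in_map_iff. now exists z.
Qed.

(** * Representatives and coordinates inside an R-class *)

(** The choice depends on the class alone: equivalent arguments hand extensionally equal predicates
    to epsilon. *)
Definition rep (E : N -> N -> Prop) (a : N) : N := epsilon (inhabits I) (fun r => E r a).

Lemma repP (E : N -> N -> Prop) (a : N) : E a a -> E (rep E a) a.
Proof. intro H. unfold rep. apply epsilon_spec. now exists a. Qed.

Lemma rep_eq (E : N -> N -> Prop) (a b : N) : (forall x, E x a <-> E x b) -> rep E a = rep E b.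
Proof.
  intro H. unfold rep. f_equal. apply functional_extensionality. intro x.
  now apply propositional_extensionality.
Qed.

Notation rrep := (rep (Req Sg)).
Notation lrep := (rep (Leq Sg)).
Notation hrep := (rep (Heq Sg)).

Lemma rrepP (a : N) : rrep a ~R a.
Proof. apply repP, Req_refl. Qed.

Lemma hrepP (a : N) : hrep a ~H a.
Proof. apply repP, Heq_refl. Qed.

Lemma lrepP (a : N) : lrep a ~L a.
Proof. apply repP, Leq_refl. Qed.

Lemma rrep_eq (a b : N) : a ~R b -> rrep a = rrep b.
Proof.
  intro H. apply rep_eq. intro x. split; intro Hx; eapply Req_trans; eauto using Req_sym.
Qed.

Lemma lrep_eq (a b : N) : a ~L b -> lrep a = lrep b.
Proof.
  intro H. apply rep_eq. intro x. split; intro Hx; eapply Leq_trans; eauto using Leq_sym.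
Qed.

Lemma hrep_eq (a b : N) : a ~H b -> hrep a = hrep b.
Proof.
  intro H. apply rep_eq. intro x. split; intro Hx; eapply Heq_trans; eauto using Heq_sym.
Qed.

Lemma lrep_inv (a b : N) : lrep a = lrep b -> a ~L b.
Proof.
  intro E. eapply Leq_trans; [apply Leq_sym, lrepP|]. rewrite E. apply lrepP.
Qed.

Lemma rrep_idem (a : N) : rrep (rrep a) = rrep a.
Proof. apply rrep_eq, rrepP. Qed.

Lemma hJ_rrep (a : N) : hJ (rrep a) = hJ a.
Proof. apply Req_hJ, rrepP. Qed.

Definition to_rep (a : N) : N := epsilon (inhabits I) (fun u => rrep a = a ** u).
Definition of_rep (a : N) : N := epsilon (inhabits I) (fun v => a = rrep a ** v).

Lemma to_repE (a : N) : a ** to_rep a = rrep a.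
Proof. symmetry. unfold to_rep. apply epsilon_spec, rrepP. Qed.

Lemma of_repE (a : N) : rrep a ** of_rep a = a.
Proof.
  symmetry. unfold of_rep. apply (epsilon_spec (inhabits I) (fun v => a = rrep a ** v)), rrepP.
Qed.

(** Green's lemma: the multipliers exchanging a and its R-representative cancel at a, hence on all
    left multiples of a. *)
Lemma to_of_rep (a b : N) : b <=L a -> b ** to_rep a ** of_rep a = b.
Proof. intros [z ->]. now rewrite <- !mulIA, (mulIA a), to_repE, of_repE. Qed.

Lemma of_to_rep (a b : N) : b <=L rrep a -> b ** of_rep a ** to_rep a = b.
Proof. intros [z ->]. now rewrite <- !mulIA, (mulIA (rrep a)), of_repE, to_repE. Qed.

Lemma to_rep_R (a b : N) : b <=L a -> b ** to_rep a ~R b.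
Proof. intro H. apply Req_mulr. exists (of_rep a). now apply to_of_rep. Qed.

(* Translate the H-class of c, by right multiplication, onto the H-class of the
   representative of its R-class. *)
Definition recenter (c : N) : N := c ** to_rep (hrep c).

Lemma recenter_R (c : N) : recenter c ~R c.
Proof. unfold recenter. apply to_rep_R. apply hrepP. Qed.

Lemma recenter_L (c : N) : recenter c ~L rrep c.
Proof.
  unfold recenter. rewrite <- (rrep_eq (hrep c) c) by apply hrepP.
  rewrite <- to_repE. apply Leq_mulr, Leq_sym, hrepP.
Qed.

Lemma recenter_H (c : N) : recenter c ~H rrep (recenter c).
Proof.
  rewrite (rrep_eq _ _ (recenter_R c)). split; [apply recenter_L|].
  eapply Req_trans; [apply recenter_R | apply Req_sym, rrepP].
Qed.

Lemma recenter_of_rep (c : N) : recenter c ** of_rep (hrep c) = c.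
Proof. unfold recenter. apply to_of_rep, hrepP. Qed.

(** [recenter] uses [to_rep (hrep c)] and not [to_rep c], so a whole H-class is moved by one
    multiplier and can be moved back. Equal images are R-equivalent, which together with c L c' puts
    c and c' in one H-class. *)
Lemma recenter_inj (c c' : N) : c ~L c' -> recenter c = recenter c' -> c = c'.
Proof.
  intros HL E. assert (HR : c ~R c').
  { eapply Req_trans; [apply Req_sym, recenter_R|]. rewrite E. apply recenter_R. }
  rewrite <- (recenter_of_rep c), <- (recenter_of_rep c'), E. do 2 f_equal. apply hrep_eq.
  now split.
Qed.

Lemma recenter_ex (x c : N) : x ~H rrep x -> c ~R x ->
  x ** of_rep (hrep c) ~H c /\ recenter (x ** of_rep (hrep c)) = x.
Proof.
  intros [HL HR] Hc. set (c' := x ** of_rep (hrep c)).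
  assert (Er : rrep (hrep c) = rrep x) by (apply rrep_eq; eapply Req_trans; [apply hrepP | exact Hc]).
  assert (Ex : c' ** to_rep (hrep c) = x).
  { apply of_to_rep. rewrite Er. apply HL. }
  assert (HL' : c' ~L c).
  { eapply Leq_trans; [apply Leq_mulr, HL|]. rewrite <- Er, of_repE. apply hrepP. }
  assert (HH : c' ~H c).
  { split; [exact HL'|]. eapply Req_trans; [|apply Req_sym, Hc].
    rewrite <- Ex. apply Req_sym, Req_mulr. exists (of_rep (hrep c)). now rewrite Ex. }
  split; [exact HH|]. unfold recenter. now rewrite (hrep_eq _ _ HH).
Qed.

(* Right translation by T on the L-class of l, transported by recenter and extended by
   the identity. *)
Definition transport (l T x : N) : N :=
  match dec (exists c, c ~L l /\ recenter c = x) with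
  | left _ => recenter (epsilon (inhabits I) (fun c => c ~L l /\ recenter c = x) ** T)
  | right _ => x
  end.

Lemma transport_recenter (l T c : N) : c ~L l -> transport l T (recenter c) = recenter (c ** T).
Proof.
  intro Hc. unfold transport. destruct (dec _) as [Hex|Hno]; [|exfalso; eauto].
  apply (epsilon_spec (inhabits I)) in Hex as [A B].
  do 2 f_equal. apply recenter_inj; [|exact B].
  eapply Leq_trans; [exact A | now apply Leq_sym].
Qed.

Lemma transport_out (l T x : N) : ~ (exists c, c ~L l /\ recenter c = x) -> transport l T x = x.
Proof. intro H. unfold transport. now destruct (dec _). Qed.

Lemma L_mul_eq (l c T T' : N) : c <=L l -> l ** T = l ** T' -> c ** T = c ** T'.
Proof. intros [z ->] E. now rewrite <- !mulIA, E. Qed.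

Lemma transport_ext (l l' T T' x : N) :
  l ~L l' -> l ** T = l ** T' -> transport l T x = transport l' T' x.
Proof.
  intros HL E. destruct (classic (exists c, c ~L l /\ recenter c = x)) as [[c [Hc <-]]|Hno].
  - rewrite !transport_recenter; [|eapply Leq_trans; eassumption|exact Hc].
    f_equal. apply (L_mul_eq l); [apply Hc | exact E].
  - rewrite !transport_out; [reflexivity| |exact Hno].
    intros [c [Hc Ec]]. apply Hno. exists c. split; [|exact Ec].
    eapply Leq_trans; [exact Hc | now apply Leq_sym].
Qed.

Lemma transport_id (l T x : N) : l ** T = l -> transport l T x = x.
Proof.
  intro E. destruct (classic (exists c, c ~L l /\ recenter c = x)) as [[c [Hc <-]]|Hno].
  - rewrite transport_recenter by exact Hc. f_equal. rewrite <- (mulI1 c) at 2.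
    apply (L_mul_eq l); [apply Hc | now rewrite mulI1].
  - now apply transport_out.
Qed.

(** Right multiplication by T keeps each R-class met by the L-class of l, so the L-classes of l and
    l T meet the same R-classes, and both sides are the identity away from them. *)
Lemma transport_comp (l T T' x : N) : l ** T ~R l -> x ~H rrep x ->
  transport (l ** T) T' (transport l T x) = transport l (T ** T') x.
Proof.
  intros HT Hx. destruct (classic (exists c, c ~L l /\ recenter c = x)) as [[c [Hc <-]]|Hno].
  - rewrite !(transport_recenter l) by exact Hc. rewrite transport_recenter by now apply Leq_mulr.
    now rewrite mulIA.
  - rewrite !(transport_out l) by exact Hno. apply transport_out.
    intros [c [Hc Ec]]. apply Hno. destruct (Req_mulr_inv _ _ HT) as [n' En].
    assert (HcR : c ** n' ~R c).
    { apply Req_mulr. exists T. destruct Hc as [[z ->] _].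
      rewrite <- !mulIA. f_equal. rewrite !mulIA. now rewrite En. }
    assert (HcL : c ** n' ~L l).
    { rewrite <- En. now apply Leq_mulr. }
    destruct (recenter_ex x (c ** n') Hx) as [A B].
    + eapply Req_trans; [exact HcR|]. rewrite <- Ec. apply Req_sym, recenter_R.
    + exists (x ** of_rep (hrep (c ** n'))). split; [|exact B].
      eapply Leq_trans; [apply A | exact HcL].
Qed.

(** In an R-class met by the L-class of l, [transport] goes from the H-class of the representative
    to that L-class, applies T and comes back; v r is the product of the three multipliers. This
    exhibits [transport] as an element of the direct sum. *)
Lemma transport_translation (l T : N) : l ** T ~R l ->
  exists (v : N -> N) (L : list N),
    (forall x, x ~H rrep x -> transport l T x = x ** v (rrep x)) /\
    (forall x, x ~H rrep x -> transport l T x ~H x) /\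
    (forall r, rrep r = r -> ~ In r L -> v r = I).
Proof.
  intro HT.
  set (P := fun r c => c ~L l /\ c ~R r).
  set (c0 := fun r => epsilon (inhabits I) (P r)).
  set (v := fun r => match dec (exists c, P r c) with
     | left _ => of_rep (hrep (c0 r)) ** T ** to_rep (hrep (c0 r ** T))
     | right _ => I end).
  assert (HTc : forall c, c ~L l -> c ** T ~R c).
  { intros c Hc. apply (Req_mulr_L l); [apply Hc | exact HT]. }
  assert (E : forall x, x ~H rrep x -> transport l T x = x ** v (rrep x) /\ transport l T x ~R x).
  { intros x Hx. unfold v. destruct (dec _) as [Hex|Hno].
    - apply (epsilon_spec (inhabits I)) in Hex. fold (c0 (rrep x)) in Hex.
      set (c := c0 (rrep x)) in *. destruct Hex as [cL cR].
      destruct (recenter_ex x c Hx) as [A B].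
      { eapply Req_trans; [exact cR | apply rrepP]. }
      set (c' := x ** of_rep (hrep c)) in *.
      assert (c'L : c' ~L l) by (eapply Leq_trans; [apply A | exact cL]).
      assert (Et : transport l T x = recenter (c' ** T)) by (rewrite <- B; now apply transport_recenter).
      rewrite Et. split.
      + unfold recenter. rewrite (hrep_eq (c' ** T) (c ** T)); [unfold c'; now rewrite !mulIA|].
        split; [apply Leq_mulr, A|].
        eapply Req_trans; [apply HTc, c'L|]. eapply Req_trans; [apply A|].
        apply Req_sym, HTc, cL.
      + eapply Req_trans; [apply recenter_R|]. eapply Req_trans; [apply HTc, c'L|].
        rewrite <- B. apply Req_sym, recenter_R.
    - rewrite mulI1. split; [|rewrite transport_out; [apply Req_refl|]];
      try apply transport_out; intros [c [Hc Ec]]; apply Hno; exists c; split; auto;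
      apply Req_sym; (eapply Req_trans; [apply rrepP|]); rewrite <- Ec; apply recenter_R. }
  (* All elements of the L-class of l are J-above l, so finitely many R-classes meet it. *)
  destruct (J_above_list l) as [L HL].
  exists v, (map (fun c => rrep c) L). split; [|split].
  - intros x Hx. now apply E.
  - intros x Hx. split; [|now apply E].
    destruct (classic (exists c, c ~L l /\ recenter c = x)) as [[c [Hc <-]]|Hno].
    + rewrite transport_recenter by exact Hc.
      eapply Leq_trans; [apply recenter_L|]. rewrite (rrep_eq _ _ (HTc c Hc)).
      apply Leq_sym, recenter_L.
    + rewrite transport_out by exact Hno. apply Leq_refl.
  - intros r Er Hr. unfold v. destruct (dec _) as [[c [cL cR]]|]; [|reflexivity].
    exfalso. apply Hr. apply in_map_iff. exists c. split.
    + rewrite <- Er. now apply rrep_eq.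
    + apply HL, Lle_Jle, cL.
Qed.

(** * Chains *)

(* The clause [a ~L y ** b] with y in Y holds in Rh_Y(M^I); it leaves at most |Y|
   L-classes for the entry following b, whence the finiteness of the levels. *)
Fixpoint chain (l : list N) : Prop :=
  match l with
  | [] => False
  | [a] => a = I
  | a :: ((b :: _) as l') => Llt Sg a b /\ (exists y, a ~L Some (iota y) ** b) /\ chain l'
  end.

(** The shape of a product before [lm] is applied: L-equivalent neighbours are still allowed. *)
Fixpoint weak_chain (l : list N) : Prop :=
  match l with
  | [] => False
  | [a] => a = I
  | a :: ((b :: _) as l') => (exists y, a ~L Some (iota y) ** b) /\ weak_chain l'
  end.

Lemma chain_weak (l : list N) : chain l -> weak_chain l.
Proof.
  induction l as [|a [|b l] IH]; intro H; [exact H | exact H|].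
  destruct H as [_ [H1 H2]]. split; [exact H1 | exact (IH H2)].
Qed.

Lemma Llt_hJ (a b : N) : Llt Sg a b -> hJ b < hJ a.
Proof.
  intros [A B]. apply hJ_lt. split; [now apply Lle_Jle|].
  intro F. now apply B, L_stable.
Qed.

Lemma chain_sorted (a : N) (l : list N) : chain (a :: l) ->
  forall x, In x l -> a <=L x /\ hJ x < hJ a.
Proof.
  revert a. induction l as [|b l IH]; intros a H x Hx; [destruct Hx|].
  destruct H as [Hab [_ H]]. destruct Hx as [<-|Hx].
  - split; [apply Hab | now apply Llt_hJ].
  - destruct (IH b H x Hx) as [A B]. apply Llt_hJ in Hab as Hh. split; [|lia].
    eapply Lle_trans; [apply Hab | exact A].
Qed.

Lemma chain_last (l : list N) : chain l -> l = removelast l ++ [I].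
Proof.
  induction l as [|a [|b l] IH]; intro H; [destruct H | now rewrite H|].
  destruct H as [_ [_ H]]. change (removelast (a :: b :: l)) with (a :: removelast (b :: l)).
  rewrite <- app_comm_cons. f_equal. exact (IH H).
Qed.

Lemma chain_ind (P : list N -> Prop) :
  P [I] ->
  (forall a l, l <> [] -> chain (a :: l) -> chain l -> (forall x, In x l -> a <=L x /\ hJ x < hJ a) ->
     P l -> P (a :: l)) ->
  forall l, chain l -> P l.
Proof.
  intros H1 H2. induction l as [|a [|b l] IH]; intro H.
  - destruct H.
  - simpl in H. now subst a.
  - apply H2; try easy; try apply H; [now apply chain_sorted|]. apply IH, H.
Qed.

Lemma not_I_Lle (y : car Sg) (b : N) : ~ I <=L Some y ** b.
Proof.
  intros [c E]. symmetry in E. apply mulI_eq1 in E as [_ E].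
  apply mulI_eq1 in E as [E _]. discriminate E.
Qed.

Lemma LeqbP (a b : N) : Leqb Sg a b = true <-> a ~L b.
Proof. unfold Leqb. destruct (dec _); split; auto; try discriminate; tauto. Qed.

Lemma lm_cons (a : N) (l : list N) : exists r, lm Sg (a :: l) = a :: r.
Proof.
  simpl. destruct (lm Sg l) as [|b r]; [now exists []|].
  destruct (Leqb Sg a b); eexists; reflexivity.
Qed.

Lemma lm_chain (l : list N) : weak_chain l -> chain (lm Sg l).
Proof.
  induction l as [|a [|b l] IH]; intro H; [destruct H | exact H|].
  destruct H as [[y Hy] H]. specialize (IH H).
  destruct (lm_cons b l) as [r E].
  change (lm Sg (a :: b :: l)) with
    (match lm Sg (b :: l) with
     | [] => [a]
     | b' :: l'' => if Leqb Sg a b' then a :: l'' else a :: b' :: l''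
     end).
  rewrite E in IH |- *. destruct (Leqb Sg a b) eqn:Eab.
  - apply LeqbP in Eab. destruct r as [|c r].
    + exfalso. simpl in IH. subst b.
      apply (not_I_Lle (iota y) I). eapply Lle_trans; [apply Eab | apply Hy].
    + destruct IH as [[A B] [[z Hz] IH]]. split; [split|split].
      * eapply Lle_trans; [apply Eab | exact A].
      * intro F. apply B. eapply Lle_trans; [exact F | apply Eab].
      * exists z. eapply Leq_trans; [exact Eab | exact Hz].
      * exact IH.
  - split; [split|split].
    + eapply Lle_trans; [apply Hy|]. now exists (Some (iota y)).
    + intro F. assert (Leqb Sg a b = true); [|congruence]. apply LeqbP.
      split; [|exact F]. eapply Lle_trans; [apply Hy|]. now exists (Some (iota y)).
    + now exists y.
    + exact IH.
Qed.

Lemma lm_id (l : list N) : chain l -> lm Sg l = l.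
Proof.
  induction l as [|a [|b l] IH]; intro H; [destruct H | reflexivity|].
  destruct H as [[_ A] [_ H]]. specialize (IH H).
  change (lm Sg (a :: b :: l)) with
    (match lm Sg (b :: l) with
     | [] => [a]
     | b' :: l'' => if Leqb Sg a b' then a :: l'' else a :: b' :: l''
     end).
  rewrite IH. destruct (Leqb Sg a b) eqn:Eab; [|reflexivity].
  apply LeqbP in Eab. exfalso. apply A, Eab.
Qed.

Definition L_invariant (P : N -> bool) : Prop := forall a b, a ~L b -> P a = P b.

(** [lm] keeps the leftmost term of each L-block and P is constant on a block, so the first hit
    survives unchanged. *)
Lemma find_lm (P : N -> bool) (l : list N) : L_invariant P -> find P (lm Sg l) = find P l.
Proof.
  intro HP. induction l as [|a l IH]; [reflexivity|]. simpl. rewrite <- IH.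
  destruct (lm Sg l) as [|b r]; [reflexivity|]. destruct (Leqb Sg a b) eqn:E; [|reflexivity].
  apply LeqbP in E. simpl. rewrite (HP a b E). now destruct (P b).
Qed.

Lemma find_app (P : N -> bool) (l l' : list N) :
  find P (l ++ l') = match find P l with Some x => Some x | None => find P l' end.
Proof. induction l as [|a l IH]; simpl; [reflexivity|]. now destruct (P a). Qed.

Lemma find_map (P : N -> bool) (f : N -> N) (l : list N) :
  find P (map f l) = option_map f (find (fun x => P (f x)) l).
Proof. induction l as [|a l IH]; simpl; [reflexivity|]. now destruct (P (f a)). Qed.

Fixpoint find_last (P : N -> bool) (l : list N) : option N :=
  match l with
  | [] => None
  | a :: l => match find_last P l with Some x => Some x | None => if P a then Some a else None end
  end.

Definition oL (o o' : option N) : Prop :=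
  match o, o' with
  | Some a, Some b => a ~L b
  | None, None => True
  | _, _ => False
  end.

Lemma oL_refl (o : option N) : oL o o.
Proof. destruct o; simpl; auto using Leq_refl. Qed.

Lemma oL_sym (o o' : option N) : oL o o' -> oL o' o.
Proof. destruct o, o'; simpl; auto using Leq_sym. Qed.

Lemma oL_trans (o1 o2 o3 : option N) : oL o1 o2 -> oL o2 o3 -> oL o1 o3.
Proof. destruct o1, o2, o3; simpl; try tauto. apply Leq_trans. Qed.

Lemma oL_map (f : N -> N) (o o' : option N) :
  (forall a b, a ~L b -> f a ~L f b) -> oL o o' -> oL (option_map f o) (option_map f o').
Proof. intro Hf. destruct o, o'; simpl; auto. Qed.

Lemma find_last_app (P : N -> bool) (l l' : list N) :
  find_last P (l ++ l') = match find_last P l' with Some x => Some x | None => find_last P l end.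
Proof.
  induction l as [|a l IH]; simpl; [now destruct (find_last P l')|].
  rewrite IH. now destruct (find_last P l').
Qed.

Lemma find_last_none (P : N -> bool) (l : list N) :
  (forall x, In x l -> P x = false) -> find_last P l = None.
Proof.
  induction l as [|a l IH]; simpl; intro H; [reflexivity|].
  rewrite IH by auto. now rewrite H by auto.
Qed.

Lemma find_last_some (P : N -> bool) (l : list N) (x : N) :
  find_last P l = Some x -> In x l /\ P x = true.
Proof.
  induction l as [|a l IH]; simpl; [discriminate|].
  destruct (find_last P l) as [z|].
  - intros [= ->]. destruct IH; auto.
  - destruct (P a) eqn:E; [|discriminate]. intros [= ->]. auto.
Qed.

(** The rightmost term of a block may be discarded by [lm], so the last hit is preserved only up to
    L-equivalence. *)
Lemma find_last_lm (P : N -> bool) (l : list N) :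
  L_invariant P -> oL (find_last P (lm Sg l)) (find_last P l).
Proof.
  intro HP. induction l as [|a l IH]; [exact Logic.I|]. simpl.
  destruct (lm Sg l) as [|b r].
  - simpl in IH |- *. destruct (find_last P l); [destruct IH|apply oL_refl].
  - destruct (Leqb Sg a b) eqn:E; simpl in IH |- *.
    + apply LeqbP in E. destruct (find_last P r) as [z|], (find_last P l) as [w|];
        simpl in IH |- *; auto; try tauto.
      * rewrite (HP a b E). destruct (P b); simpl in IH |- *; [|tauto].
        eapply Leq_trans; eassumption.
      * destruct (P b) eqn:Eb; simpl in IH; [tauto|]. rewrite (HP a b E), Eb. exact Logic.I.
    + destruct (find_last P r) as [z|], (find_last P l) as [w|]; simpl in IH |- *; auto; try tauto.
      * destruct (P b) eqn:Eb; simpl in IH |- *; [exact IH|tauto].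
      * destruct (P b) eqn:Eb; simpl in IH; [tauto|]. apply oL_refl.
Qed.

(** * Entries of a chain sorted by height *)

Definition below (k : nat) (x : N) : bool := hJ x <? k.
Definition above (k : nat) (x : N) : bool := k <=? hJ x.
Definition low (k : nat) (l : list N) : list N := filter (below k) l.
(** Heights decrease along the list, so the first hit is the deepest entry of height less than k. In
    a chain the default I occurs for k = 0 only, as a formal predecessor of the entry I. *)
Definition pre (k : nat) (l : list N) : N :=
  match find (below k) l with Some x => x | None => I end.
(** Read from the right end, this is the shallowest entry of height at least k: the one just below
    [pre k l] when 1 <= k. *)
Definition nxt (k : nat) (l : list N) : option N := find_last (above k) l.

Lemma belowP (k : nat) (x : N) : reflect (hJ x < k) (below k x).
Proof. apply Nat.ltb_spec0. Qed.

Lemma aboveP (k : nat) (x : N) : reflect (k <= hJ x) (above k x).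
Proof. apply Nat.leb_spec0. Qed.

Lemma pre_0 (l : list N) : find (below 0) l = None /\ pre 0 l = I.
Proof.
  assert (H : find (below 0) l = None).
  { induction l as [|a l IH]; simpl; [reflexivity|]. now destruct (belowP 0 a). }
  split; [exact H|]. unfold pre. now rewrite H.
Qed.

Lemma below_inv (k : nat) (n : N) : L_invariant (fun x => below k (x ** n)).
Proof. intros a b H. unfold below. now rewrite (Leq_hJ _ _ (Leq_mulr _ _ n H)). Qed.

Lemma below_inv1 (k : nat) : L_invariant (below k).
Proof. intros a b H. unfold below. now rewrite (Leq_hJ _ _ H). Qed.

Lemma above_inv (k : nat) : L_invariant (above k).
Proof. intros a b H. unfold above. now rewrite (Leq_hJ _ _ H). Qed.

Lemma find_filter (P : N -> bool) (l : list N) :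
  find P l = match filter P l with [] => None | x :: _ => Some x end.
Proof. induction l as [|a l IH]; simpl; [reflexivity|]. now destruct (P a). Qed.

Lemma low_low (j k : nat) (l : list N) : j <= k -> low j (low k l) = low j l.
Proof.
  intro Hjk. unfold low. induction l as [|a l IH]; simpl; [reflexivity|].
  destruct (belowP k a); simpl; destruct (belowP j a); rewrite ?IH; auto; lia.
Qed.

Lemma low_all (k : nat) (l : list N) : (forall x, In x l -> hJ x < k) -> low k l = l.
Proof.
  intro H. induction l as [|a l IH]; simpl; [reflexivity|].
  destruct (belowP k a) as [A|A]; [|exfalso; apply A, H; now left].
  f_equal. apply IH. intros. apply H. now right.
Qed.

Lemma low_In (k : nat) (l : list N) (x : N) : In x (low k l) <-> In x l /\ hJ x < k.
Proof. unfold low. rewrite filter_In. now destruct (belowP k x). Qed.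

Lemma pre_low (k : nat) (l : list N) : pre k l = hd I (low k l).
Proof. unfold pre, low. rewrite find_filter. now destruct (filter (below k) l). Qed.

Lemma pre_low_eq (j k : nat) (l l' : list N) : j <= k -> low k l = low k l' -> pre j l = pre j l'.
Proof.
  intros Hjk E. rewrite !pre_low, <- (low_low j k l), <- (low_low j k l'), E by easy. reflexivity.
Qed.

Lemma pre_cons (k : nat) (a : N) (l : list N) :
  pre k (a :: l) = if below k a then a else pre k l.
Proof. unfold pre. simpl. now destruct (below k a). Qed.

Lemma low_cons (k : nat) (a : N) (l : list N) :
  low k (a :: l) = if below k a then a :: low k l else low k l.
Proof. reflexivity. Qed.

Lemma nxt_cons (k : nat) (a : N) (l : list N) :
  nxt k (a :: l) = match nxt k l with Some x => Some x | None => if above k a then Some a else None end.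
Proof. reflexivity. Qed.

Lemma low_S (k : nat) (l : list N) : chain l ->
  low (S k) l = if hJ (pre (S k) l) =? k then pre (S k) l :: low k l else low k l.
Proof.
  revert l. apply chain_ind.
  - rewrite !low_cons, pre_cons. destruct (belowP (S k) I) as [A|A]; rewrite hJ_I in A; [|lia].
    rewrite hJ_I. destruct (belowP k I) as [B|B]; rewrite hJ_I in B; destruct k; try lia; reflexivity.
  - intros a l _ _ _ Hs IH. rewrite !low_cons, pre_cons.
    destruct (belowP (S k) a) as [A|A].
    + assert (El : forall j, hJ a <= j -> low j l = l).
      { intros j Hj. apply low_all. intros x Hx. apply Hs in Hx. lia. }
      rewrite !El by lia.
      destruct (Nat.eqb_spec (hJ a) k), (belowP k a); try lia; reflexivity.
    + destruct (belowP k a); [lia|]. exact IH.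
Qed.

Lemma low_eq (k : nat) (l l' : list N) : chain l -> chain l' ->
  (forall j, j <= k -> pre j l = pre j l') -> low k l = low k l'.
Proof.
  intros Hl Hl'. induction k as [|k IH]; intro H.
  - unfold low. transitivity (@nil N); [|symmetry];
    (match goal with |- filter _ ?l = _ => clear; induction l as [|a l IH]; [reflexivity|] end);
    simpl; destruct (belowP 0 a); [lia|exact IH|lia|exact IH].
  - rewrite !low_S, H, IH by auto. reflexivity.
Qed.

Lemma chain_hJ_hd (l : list N) : chain l -> forall x, In x l -> hJ x <= hJ (hd I l).
Proof.
  destruct l as [|a l]; [intros []|]. intros H x [<-|Hx]; simpl; [lia|].
  apply (chain_sorted a l H) in Hx. lia.
Qed.

Lemma low_full (k : nat) (l : list N) : chain l -> hJ (hd I l) < k -> low k l = l.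
Proof.
  intros Hl Hk. apply low_all. intros x Hx. apply (chain_hJ_hd l Hl) in Hx. lia.
Qed.

Lemma chain_eq (l l' : list N) : chain l -> chain l' -> (forall k, pre k l = pre k l') -> l = l'.
Proof.
  intros Hl Hl' H. set (k := S (hJ (hd I l) + hJ (hd I l'))).
  rewrite <- (low_full k l), <- (low_full k l') by (auto; unfold k; lia).
  now apply low_eq.
Qed.

(** * The Rhodes product read height by height *)

Lemma chain_nonnil (l : list N) : chain l -> exists a r, l = a :: r.
Proof. destruct l as [|a r]; [intros []|eauto]. Qed.

Lemma rh_raw_hd (s t : list N) : chain s -> chain t ->
  exists r, map (fun x => x ** hd I t) (removelast s) ++ t = hd I s ** hd I t :: r.
Proof.
  intros Hs Ht. destruct s as [|a [|b s]]; [destruct Hs| |].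
  - simpl in Hs. subst a. destruct (chain_nonnil t Ht) as [c [r ->]]. now exists r.
  - change (removelast (a :: b :: s)) with (a :: removelast (b :: s)). simpl. eauto.
Qed.

Lemma hd_rh (s t : list N) : chain s -> chain t -> hd I (rh_mul Sg s t) = hd I s ** hd I t.
Proof.
  intros Hs Ht. unfold rh_mul. destruct (rh_raw_hd s t Hs Ht) as [r ->].
  destruct (lm_cons (hd I s ** hd I t) r) as [r' ->]. reflexivity.
Qed.

Lemma chain_rh (s t : list N) : chain s -> chain t -> chain (rh_mul Sg s t).
Proof.
  intros Hs Ht. apply lm_chain.
  induction s as [|a [|b s] IH]; [destruct Hs|now apply chain_weak|].
  destruct Hs as [_ [[y Hy] Hs]].
  change (removelast (a :: b :: s)) with (a :: removelast (b :: s)).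
  specialize (IH Hs). destruct (rh_raw_hd (b :: s) t Hs Ht) as [r E].
  cbn [map app]. rewrite E in IH |- *. split; [|exact IH].
  exists y. simpl hd. rewrite mulIA. now apply Leq_mulr.
Qed.

(** On the right all of s is translated, its final I included. This only inserts another copy of n
    before t, whose leftmost term is n already. *)
Lemma find_rh (P : N -> bool) (s t : list N) : L_invariant P -> chain s -> chain t ->
  find P (rh_mul Sg s t) = find P (map (fun x => x ** hd I t) s ++ t).
Proof.
  intros HP Hs Ht. unfold rh_mul. rewrite find_lm by exact HP.
  rewrite (chain_last s Hs) at 2. rewrite map_app, <- app_assoc, !find_app.
  destruct (find P (map _ (removelast s))); [reflexivity|].
  destruct (chain_nonnil t Ht) as [c [r ->]]. simpl. now destruct (P c).
Qed.

Lemma nxt_rh (k : nat) (s t : list N) : chain s -> chain t ->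
  oL (nxt k (rh_mul Sg s t)) (nxt k (map (fun x => x ** hd I t) s ++ t)).
Proof.
  intros Hs Ht. eapply oL_trans; [apply find_last_lm, above_inv|].
  rewrite (chain_last s Hs) at 2. unfold nxt. rewrite map_app, <- app_assoc, !find_last_app.
  destruct (chain_nonnil t Ht) as [c [r ->]]. simpl.
  destruct (find_last (above k) r); [apply oL_refl|].
  destruct (above k c); apply oL_refl.
Qed.

(** A chain is determined by its [pre k]. For both bracketings the search for [pre k] visits
    translates of s, t and u in this order, with multipliers that agree by associativity in M^I. *)
Lemma rh_assoc (s t u : list N) : chain s -> chain t -> chain u ->
  rh_mul Sg (rh_mul Sg s t) u = rh_mul Sg s (rh_mul Sg t u).
Proof.
  intros Hs Ht Hu. apply chain_eq; auto using chain_rh. intro k. unfold pre.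
  rewrite !find_rh by auto using chain_rh, below_inv1.
  rewrite !find_app, hd_rh, (find_map _ _ (rh_mul Sg s t)) by auto.
  rewrite !find_rh by auto using below_inv, below_inv1.
  rewrite !find_app, !find_map.
  assert (E : (fun x => below k (x ** (hd I t ** hd I u))) = (fun x => below k (x ** hd I t ** hd I u))).
  { apply functional_extensionality. intro x. now rewrite mulIA. }
  rewrite E. destruct (find _ s) as [x|]; simpl; [now rewrite mulIA|].
  destruct (find _ t) as [x|]; reflexivity.
Qed.

Lemma rh_1l (t : list N) : chain t -> rh_mul Sg (rh_one Sg) t = t.
Proof. exact (lm_id t). Qed.

Lemma rh_1r (s : list N) : chain s -> rh_mul Sg s (rh_one Sg) = s.
Proof.
  intro Hs. unfold rh_mul. simpl hd.
  rewrite (map_ext _ (fun x => x)) by apply mulI1. rewrite map_id.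
  unfold rh_one. rewrite <- chain_last by exact Hs. now apply lm_id.
Qed.

Lemma chain_one : chain (rh_one Sg).
Proof. reflexivity. Qed.

Lemma inRhY_chain (s : list N) : inRhY Sg Y iota s -> chain s.
Proof.
  induction 1 as [|y|s t _ IHs _ IHt]; [reflexivity| |now apply chain_rh].
  split; [split|split; [|reflexivity]].
  - exists (Some (iota y)). now rewrite mulI1.
  - intro F. apply (not_I_Lle (iota y) I). now rewrite mulI1.
  - exists y. rewrite mulI1. apply Leq_refl.
Qed.

Lemma chain_hd_I (s : list N) : chain s -> hd I s = I -> s = rh_one Sg.
Proof.
  destruct s as [|a [|b s]]; [intros []| |]; simpl.
  - now intros ->.
  - intros [A _] ->. apply Llt_hJ in A. rewrite hJ_I in A. lia.
Qed.

(** Used in [phi_mul]: the identity chain acts on all tuples and the other chains only on some, so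
    no product of the latter may be the identity chain. *)
Lemma rh_not_one (s t : list N) : chain s -> chain t ->
  rh_mul Sg s t = rh_one Sg -> s = rh_one Sg /\ t = rh_one Sg.
Proof.
  intros Hs Ht E. pose proof (hd_rh s t Hs Ht) as H. rewrite E in H. simpl in H.
  symmetry in H. apply mulI_eq1 in H as [A B]. auto using chain_hd_I.
Qed.

Lemma pre_spec (k : nat) (l : list N) : chain l -> 1 <= k -> In (pre k l) l /\ hJ (pre k l) < k.
Proof.
  intros Hl Hk. revert l Hl. apply chain_ind.
  - rewrite pre_cons. destruct (below k I); unfold pre; simpl; rewrite hJ_I; auto.
  - intros a l _ _ _ _ [A B]. rewrite pre_cons.
    destruct (belowP k a) as [C|C]; simpl; auto.
Qed.

Lemma pre_low_le (k : nat) (l : list N) (x : N) : chain l -> In x (low k l) -> pre k l <=L x.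
Proof.
  intro Hl. rewrite low_In. intros [Hx Hk]. revert l Hl Hx. apply (chain_ind (fun l => _ -> _)).
  - intros [<-|[]]. rewrite pre_cons. destruct (belowP k I); [apply Lle_refl|contradiction].
  - intros a l _ _ _ Hs IH Hx. rewrite pre_cons. destruct (belowP k a) as [C|C].
    + destruct Hx as [<-|Hx]; [apply Lle_refl | now apply Hs].
    + destruct Hx as [<-|Hx]; [contradiction | auto].
Qed.

Lemma pre_mono (j k : nat) (l : list N) : chain l -> j <= k -> pre k l <=L pre j l.
Proof.
  intros Hl Hjk. destruct j as [|j].
  - rewrite (proj2 (pre_0 l)). exists (pre k l). now rewrite mulI1.
  - destruct (pre_spec (S j) l Hl) as [A B]; [lia|]. apply pre_low_le; [exact Hl|].
    apply low_In. split; [exact A | lia].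
Qed.

Lemma nxt_child (k : nat) (l : list N) (m : N) : chain l -> 1 <= k -> nxt k l = Some m ->
  exists y, m ~L Some (iota y) ** pre k l.
Proof.
  intros Hl Hk. revert l Hl m. apply (chain_ind (fun l => forall m, _ -> _)).
  - intro m. rewrite nxt_cons. simpl. destruct (aboveP k I) as [A|A]; [|discriminate].
    rewrite hJ_I in A. lia.
  - intros a l Hne Hg Hl Hs IH m. rewrite nxt_cons, pre_cons.
    destruct (belowP k a) as [C|C].
    + intro E. exfalso. destruct (nxt k l) as [z|] eqn:Ez.
      * apply find_last_some in Ez as [A B]. apply Hs in A.
        destruct (aboveP k z); [lia|discriminate].
      * destruct (aboveP k a); [lia|discriminate].
    + destruct (nxt k l) as [z|] eqn:Ez; [intros [= <-]; now apply IH|].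
      destruct (aboveP k a) as [D|D]; [|discriminate]. intros [= <-].
      destruct l as [|b l]; [now destruct Hne|]. destruct Hg as [_ [[y Hy] _]].
      exists y. rewrite pre_cons. destruct (belowP k b) as [F|F]; [exact Hy|].
      exfalso. rewrite nxt_cons in Ez. destruct (nxt k l); [discriminate|].
      destruct (aboveP k b); [discriminate|lia].
Qed.

Lemma nxt_below (k : nat) (l : list N) (m : N) : chain l -> nxt k l = Some m -> m <=L pre k l.
Proof.
  intros Hl E. destruct k as [|k].
  - rewrite (proj2 (pre_0 l)). exists m. now rewrite mulI1.
  - destruct (nxt_child (S k) l m Hl) as [y Hy]; [lia|exact E|].
    eapply Lle_trans; [apply Hy|]. now exists (Some (iota y)).
Qed.

Lemma nxt_pre (k : nat) (l : list N) (m : N) : chain l -> nxt k l = Some m -> hJ m = k ->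
  pre (S k) l = m.
Proof.
  intros Hl. revert l Hl m. apply (chain_ind (fun l => forall m, _ -> _ -> _)).
  - intro m. rewrite nxt_cons, pre_cons. simpl.
    destruct (aboveP k I) as [A|A]; [|discriminate]. intros [= <-] E.
    destruct (belowP (S k) I); [reflexivity|lia].
  - intros a l _ _ _ Hs IH m. rewrite nxt_cons, pre_cons.
    destruct (nxt k l) as [z|] eqn:Ez.
    + intros [= <-] E. apply find_last_some in Ez as [A B]. apply Hs in A.
      destruct (belowP (S k) a); [lia|]. now apply IH.
    + destruct (aboveP k a) as [D|D]; [|discriminate]. intros [= <-] E.
      destruct (belowP (S k) a); [reflexivity|lia].
Qed.

Lemma pre_nxt (k : nat) (l : list N) : chain l -> hJ (pre (S k) l) = k ->
  nxt k l = Some (pre (S k) l).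
Proof.
  intros Hl. revert l Hl. apply (chain_ind (fun l => _ -> _)).
  - rewrite nxt_cons, pre_cons. simpl.
    destruct (belowP (S k) I) as [A|A]; rewrite hJ_I in A; [|lia].
    rewrite hJ_I. intros <-. destruct (aboveP 0 I); [reflexivity|lia].
  - intros a l _ _ _ Hs IH. rewrite nxt_cons, pre_cons.
    destruct (belowP (S k) a) as [A|A].
    + intro E. unfold nxt. rewrite find_last_none; [destruct (aboveP k a); [reflexivity|lia]|].
      intros x Hx. apply Hs in Hx. destruct (aboveP k x); [lia|reflexivity].
    + intro E. now rewrite IH.
Qed.

Lemma pre_blank (k : nat) (l : list N) : chain l -> hJ (pre (S k) l) <> k ->
  pre (S k) l = pre k l /\ low (S k) l = low k l /\ nxt (S k) l = nxt k l /\ 1 <= k.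
Proof.
  intros Hl E. pose proof (low_S k l Hl) as H.
  destruct (Nat.eqb_spec (hJ (pre (S k) l)) k) as [F|F]; [contradiction|].
  split; [now rewrite !pre_low, H|]. split; [exact H|]. split.
  - unfold nxt. clear -H. induction l as [|a l IH]; [reflexivity|]. simpl.
    rewrite !low_cons in H.
    destruct (belowP (S k) a) as [A|A], (belowP k a) as [B|B]; try lia.
    + injection H as H. rewrite IH by exact H.
      destruct (aboveP (S k) a), (aboveP k a); try lia; reflexivity.
    + exfalso. assert (Hin : In a (low k l)) by (rewrite <- H; now left).
      apply low_In in Hin. lia.
    + rewrite IH by exact H. destruct (aboveP (S k) a), (aboveP k a); try lia; reflexivity.
  - destruct (pre_spec (S k) l Hl) as [_ A]; lia.
Qed.

(** Right multiplication never lowers the height, so an entry of height at least k cannot be hit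
    below j. *)
Lemma find_map_low (j k : nat) (n : N) (l : list N) : j <= k ->
  find (below j) (map (fun x => x ** n) l) = find (below j) (map (fun x => x ** n) (low k l)).
Proof.
  intro Hjk. induction l as [|a l IH]; [reflexivity|]. rewrite low_cons. simpl.
  destruct (belowP k a) as [A|A]; simpl; [now rewrite IH|].
  destruct (belowP j (a ** n)) as [B|B]; [|exact IH].
  pose proof (hJ_mulr a n). lia.
Qed.

Lemma low_rh (k : nat) (s s' t : list N) : chain s -> chain s' -> chain t ->
  low k s = low k s' -> low k (rh_mul Sg s t) = low k (rh_mul Sg s' t).
Proof.
  intros Hs Hs' Ht E. apply low_eq; auto using chain_rh. intros j Hj. unfold pre.
  rewrite !find_rh by auto using below_inv1. rewrite !find_app.
  rewrite (find_map_low j k _ s Hj), (find_map_low j k _ s' Hj). now rewrite E.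
Qed.

(** The entries of [low k l] stand at the right end, so a translate of one of them that reaches
    height k is met first. Otherwise the translate of [nxt k l] is met, since its height has not
    decreased. *)
Lemma nxt_map (k : nat) (n : N) (l : list N) : chain l ->
  nxt k (map (fun x => x ** n) l) =
  match nxt k (map (fun x => x ** n) (low k l)) with
  | Some x => Some x
  | None => option_map (fun x => x ** n) (nxt k l)
  end.
Proof.
  revert l. apply chain_ind.
  - rewrite low_cons. simpl map. unfold nxt. simpl.
    destruct (belowP k I) as [A|A]; simpl; [destruct (aboveP k I); [lia|]; now destruct (above k n)|].
    destruct (aboveP k I); [|lia]. simpl.
    assert (k = 0) by (rewrite hJ_I in A; lia). subst k.
    destruct (aboveP 0 n); [reflexivity|lia].
  - intros a l _ _ _ Hs IH. rewrite low_cons, nxt_cons. simpl map.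
    destruct (belowP k a) as [A|A].
    + replace (low k l) with l.
      2:{ symmetry. apply low_all. intros x Hx. apply Hs in Hx. lia. }
      replace (nxt k l) with (@None N).
      2:{ symmetry. apply find_last_none. intros x Hx. apply Hs in Hx.
          destruct (aboveP k x); [lia|reflexivity]. }
      destruct (aboveP k a); [lia|]. cbn [map]. now destruct (nxt k (a ** n :: _)).
    + rewrite nxt_cons, IH. destruct (nxt k (map _ (low k l))); [reflexivity|].
      destruct (nxt k l); [reflexivity|]. simpl. pose proof (hJ_mulr a n).
      destruct (aboveP k a), (aboveP k (a ** n)); try lia; reflexivity.
Qed.

Lemma nxt_prod (k : nat) (s t : list N) : chain s -> chain t ->
  oL (nxt k (rh_mul Sg s t))
     (match nxt k t with
      | Some x => Some x
      | None => match nxt k (map (fun x => x ** hd I t) (low k s)) with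
                | Some x => Some x
                | None => option_map (fun x => x ** hd I t) (nxt k s)
                end
      end).
Proof.
  intros Hs Ht. eapply oL_trans; [now apply nxt_rh|].
  unfold nxt at 1. rewrite find_last_app. fold (nxt k t).
  fold (nxt k (map (fun x => x ** hd I t) s)). rewrite nxt_map by exact Hs. apply oL_refl.
Qed.

Lemma nxt_rh_eq (k : nat) (s s' t : list N) : chain s -> chain s' -> chain t ->
  low k s = low k s' -> oL (nxt k s) (nxt k s') ->
  oL (nxt k (rh_mul Sg s t)) (nxt k (rh_mul Sg s' t)).
Proof.
  intros Hs Hs' Ht E EL. eapply oL_trans; [now apply nxt_prod|].
  eapply oL_trans; [|apply oL_sym; now apply nxt_prod]. rewrite E.
  destruct (nxt k t); [apply oL_refl|]. destruct (nxt k (map _ _)); [apply oL_refl|].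
  apply oL_map; [|exact EL]. intros. now apply Leq_mulr.
Qed.

(** Entries deeper than [pre k s] stay at height at least k after translation, so the translate of
    [pre k s] is the first hit. *)
Lemma pre_rh_R (k : nat) (s t : list N) : chain s -> chain t ->
  pre k s ** hd I t ~R pre k s -> pre k (rh_mul Sg s t) = pre k s ** hd I t.
Proof.
  intros Hs Ht HR. apply Req_hJ in HR. set (n := hd I t) in *.
  unfold pre. rewrite find_rh by auto using below_inv1. rewrite find_app. fold n.
  assert (H : match find (below k) s with
              | Some a => find (below k) (map (fun x => x ** n) s) = Some (a ** n)
              | None => k = 0
              end).
  { destruct (find (below k) s) as [a|] eqn:Ea.
    - unfold pre in HR. rewrite Ea in HR. clear -HR Ea HJ.
      induction s as [|b s IH]; [discriminate|]. simpl in *.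
      destruct (belowP k b) as [A|A].
      + injection Ea as ->. destruct (belowP k (a ** n)); [reflexivity|lia].
      + destruct (belowP k (b ** n)); [pose proof (hJ_mulr b n); lia|]. auto.
    - destruct k as [|k]; [reflexivity|]. exfalso. rewrite (chain_last s Hs), find_app in Ea.
      destruct (find _ (removelast s)); [discriminate|]. simpl in Ea.
      destruct (belowP (S k) I) as [A|A]; [discriminate|]. rewrite hJ_I in A. lia. }
  destruct (find (below k) s) as [a|] eqn:Ea.
  - now rewrite H.
  (* Here [pre 0 s] is I, and n R-equivalent to I has height 0, so n = I. *)
  - subst k. unfold pre in HR. rewrite Ea, hJ_I in HR. apply hJ_eq0 in HR.
    now rewrite HR, !(fun l => proj1 (pre_0 l)).
Qed.

(** The element [pre k s ** n] is L-below n and below the translates of [low k s], and its height is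
    less than k. Hence t and these translates stay below height k, and the next entry comes from
    [nxt k s]. *)
Lemma nxt_rh_R (k : nat) (s t : list N) : chain s -> chain t -> 1 <= k ->
  pre k s ** hd I t ~R pre k s ->
  oL (nxt k (rh_mul Sg s t)) (option_map (fun x => x ** hd I t) (nxt k s)).
Proof.
  intros Hs Ht Hk HR. eapply oL_trans; [now apply nxt_prod|].
  destruct (pre_spec k s Hs Hk) as [_ Hp]. apply Req_hJ in HR.
  replace (nxt k t) with (@None N).
  2:{ symmetry. apply find_last_none. intros x Hx. destruct (aboveP k x) as [A|A]; [|reflexivity].
      apply (chain_hJ_hd t Ht) in Hx.
      assert (hJ (hd I t) <= hJ (pre k s ** hd I t)); [|lia].
      apply hJ_Lle. now exists (pre k s). }
  replace (nxt k (map _ (low k s))) with (@None N); [apply oL_refl|].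
  symmetry. apply find_last_none. intros z [x [<- Hx]]%in_map_iff.
  destruct (aboveP k (x ** hd I t)) as [A|A]; [|reflexivity].
  assert (hJ (x ** hd I t) <= hJ (pre k s ** hd I t)); [|lia].
  apply hJ_Lle, Lle_mulr. now apply pre_low_le.
Qed.

(** * Coordinates of a chain and their local maps *)

(* [coord_odd k] names, relative to the entry of height k - 1, the L-class of the
   next entry of the chain; [coord_even k] then locates the entry of height k
   inside its L-class.  Both are read after translating the preceding entry to
   the representative of its R-class, which makes them insensitive to right
   multiplications that keep this R-class. *)
Definition coord_odd (k : nat) (s : list N) : option N :=
  match k with
  | 0 => None
  | S k' => if hJ (pre k s) =? k'
            then option_map (fun m => lrep (m ** to_rep (pre k s))) (nxt k s)
            else None
  end.

Definition coord_even (k : nat) (s : list N) : option N :=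
  if hJ (pre (S k) s) =? k then Some (recenter (pre (S k) s ** to_rep (pre k s))) else None.

Definition coord (i : nat) (s : list N) : option N :=
  if Nat.even i then coord_even (pred (Nat.div2 i)) s else coord_odd (Nat.div2 i) s.

Lemma coord_2k1 (k : nat) (s : list N) : coord (S (2 * k)) s = coord_odd k s.
Proof.
  unfold coord. now rewrite Nat.even_succ, <- Nat.negb_even, Nat.even_even, Nat.div2_succ_double.
Qed.

Lemma coord_2k2 (k : nat) (s : list N) : coord (S (S (2 * k))) s = coord_even k s.
Proof.
  unfold coord. replace (S (S (2 * k))) with (2 * S k) by lia.
  now rewrite Nat.even_even, Nat.div2_double.
Qed.

Lemma parity (p : nat) : exists k, p = 2 * k \/ p = S (2 * k).
Proof. destruct (Nat.Even_or_Odd p) as [[k H]|[k H]]; exists k; lia. Qed.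

(** What the first i coordinates know of a chain, as [encode_agree] and [agree_encode] show: the low
    entries exactly, the next one up to L-equivalence. For even i the second index lags by one,
    since the odd coordinate that updates it is still to come. *)
Definition agree (i : nat) (s s' : list N) : Prop :=
  low (Nat.div2 i) s = low (Nat.div2 i) s' /\
  oL (nxt (Nat.div2 (pred i)) s) (nxt (Nat.div2 (pred i)) s').

Lemma agree_odd (k : nat) (s s' : list N) :
  agree (S (2 * k)) s s' <-> low k s = low k s' /\ oL (nxt k s) (nxt k s').
Proof. unfold agree. rewrite Nat.div2_succ_double, Nat.pred_succ, Nat.div2_double. tauto. Qed.

Lemma agree_even (k : nat) (s s' : list N) :
  agree (2 * S k) s s' <-> low (S k) s = low (S k) s' /\ oL (nxt k s) (nxt k s').
Proof.
  unfold agree. rewrite Nat.div2_double. replace (pred (2 * S k)) with (S (2 * k)) by lia.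
  rewrite Nat.div2_succ_double. tauto.
Qed.

Lemma nxt_0 (s : list N) : chain s -> nxt 0 s = Some I.
Proof.
  revert s. apply chain_ind.
  - rewrite nxt_cons. destruct (aboveP 0 I); [reflexivity|lia].
  - intros a l _ _ _ _ IH. now rewrite nxt_cons, IH.
Qed.

Lemma agree_0 (s s' : list N) : chain s -> chain s' -> agree 0 s s'.
Proof.
  intros Hs Hs'. split; simpl.
  - apply low_eq; auto. intros j Hj. assert (j = 0) by lia. subst j.
    now rewrite !(fun l => proj2 (pre_0 l)).
  - rewrite !nxt_0 by auto. apply Leq_refl.
Qed.

(** Taken from [nxt k] and not from [pre (S k)], so that its presence and its L-class can be read
    from the first 2k + 1 coordinates. *)
Definition entry (k : nat) (s : list N) : option N :=
  match nxt k s with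
  | Some m => if hJ m =? k then Some m else None
  | None => None
  end.

Lemma entry_some (k : nat) (s : list N) (m : N) : chain s -> entry k s = Some m ->
  nxt k s = Some m /\ hJ m = k /\ pre (S k) s = m.
Proof.
  unfold entry. intro Hs. destruct (nxt k s) as [z|] eqn:Ez; [|discriminate].
  destruct (Nat.eqb_spec (hJ z) k); [|discriminate]. intros [= ->].
  auto using nxt_pre.
Qed.

Lemma entry_pre (k : nat) (s : list N) : chain s -> hJ (pre (S k) s) = k ->
  entry k s = Some (pre (S k) s).
Proof.
  intros Hs H. unfold entry. rewrite pre_nxt by auto. now rewrite H, Nat.eqb_refl.
Qed.

Lemma entry_none (k : nat) (s : list N) : chain s -> entry k s = None <-> hJ (pre (S k) s) <> k.
Proof.
  intro Hs. split.
  - intros H Hh. rewrite entry_pre in H by auto. discriminate.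
  - intro H. destruct (entry k s) as [m|] eqn:Em; [|reflexivity].
    apply entry_some in Em as [_ [A B]]; auto. congruence.
Qed.

Lemma entry_L (k : nat) (s s' : list N) : oL (nxt k s) (nxt k s') -> oL (entry k s) (entry k s').
Proof.
  unfold entry. destruct (nxt k s) as [m|], (nxt k s') as [m'|]; simpl; try tauto.
  intro H. rewrite (Leq_hJ _ _ H). now destruct (hJ m' =? k).
Qed.

Lemma coord_agree (p : nat) (s s' : list N) : agree (S p) s s' -> coord (S p) s = coord (S p) s'.
Proof.
  destruct (parity p) as [k [-> | ->]].
  - rewrite agree_odd, !coord_2k1. intros [A B]. destruct k as [|k]; [reflexivity|].
    unfold coord_odd. rewrite (pre_low_eq (S k) (S k) s s') by auto.
    destruct (hJ _ =? k); [|reflexivity].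
    destruct (nxt (S k) s), (nxt (S k) s'); simpl in *; try tauto.
    f_equal. apply lrep_eq. now apply Leq_mulr.
  - replace (S (S (2 * k))) with (2 * S k) at 1 by lia. rewrite agree_even, !coord_2k2.
    intros [A _].
    unfold coord_even. rewrite (pre_low_eq (S k) (S k) s s'), (pre_low_eq k (S k) s s') by auto.
    reflexivity.
Qed.

Lemma agree_step (p : nat) (s s' : list N) : chain s -> chain s' ->
  agree p s s' -> coord (S p) s = coord (S p) s' -> agree (S p) s s'.
Proof.
  intros Hs Hs'. destruct (parity p) as [k [-> | ->]].
  - intro HE. rewrite !coord_2k1, agree_odd. intro HC. destruct k as [|k].
    { split; [apply HE|]. rewrite !nxt_0 by auto. apply Leq_refl. }
    apply agree_even in HE as [A B]. split; [exact A|].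
    assert (Ep : pre (S k) s = pre (S k) s') by now apply (pre_low_eq (S k) (S k)).
    unfold coord_odd in HC. rewrite <- Ep in HC. set (a := pre (S k) s) in *.
    destruct (Nat.eqb_spec (hJ a) k) as [Hh|Hh].
    + destruct (nxt (S k) s) as [m|] eqn:Em, (nxt (S k) s') as [m'|] eqn:Em'; simpl in *; try discriminate; auto.
      injection HC as HC. apply lrep_inv in HC. apply (Leq_mulr _ _ (of_rep a)) in HC.
      apply nxt_below in Em, Em'; auto. rewrite <- Ep in Em'.
      now rewrite !to_of_rep in HC.
    (* Without an entry of height k, [nxt (S k)] is [nxt k], which is known already; this is why the
       coordinate may be blank. *)
    + destruct (pre_blank k s Hs Hh) as [_ [_ [-> _]]].
      destruct (pre_blank k s' Hs') as [_ [_ [-> _]]]; [now rewrite <- Ep|]. exact B.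
  - rewrite agree_odd, !coord_2k2. intros [A B] HC.
    replace (S (S (2 * k))) with (2 * S k) by lia. apply agree_even. split; [|exact B].
    assert (Ep : pre k s = pre k s') by now apply (pre_low_eq k k).
    rewrite !low_S, A by auto. unfold coord_even in HC. rewrite <- Ep in HC.
    destruct (Nat.eqb_spec (hJ (pre (S k) s)) k) as [Hh|Hh],
      (Nat.eqb_spec (hJ (pre (S k) s')) k) as [Hh'|Hh']; try discriminate; [|reflexivity].
    f_equal. injection HC as HC. apply pre_nxt in Hh, Hh'; auto. rewrite Hh, Hh' in B. simpl in B.
    apply recenter_inj in HC; [|now apply Leq_mulr].
    apply (f_equal (fun x => x ** of_rep (pre k s))) in HC.
    apply nxt_below in Hh, Hh'; auto. rewrite <- Ep in Hh'. now rewrite !to_of_rep in HC.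
Qed.

Lemma agree_pred (p : nat) (s s' : list N) :
  chain s -> chain s' -> agree (S p) s s' -> agree p s s'.
Proof.
  intros Hs Hs'. destruct (parity p) as [k [-> | ->]].
  - destruct k as [|k]; [intro; now apply agree_0|]. rewrite agree_odd, agree_even. intros [A B].
    split; [exact A|]. assert (Ep : pre (S k) s = pre (S k) s') by now apply (pre_low_eq (S k) (S k)).
    destruct (Nat.eq_dec (hJ (pre (S k) s)) k) as [Hh|Hh].
    + rewrite pre_nxt by auto. rewrite Ep in Hh. rewrite pre_nxt, Ep by auto. apply Leq_refl.
    + destruct (pre_blank k s Hs Hh) as [_ [_ [<- _]]].
      destruct (pre_blank k s' Hs') as [_ [_ [<- _]]]; [now rewrite <- Ep|]. exact B.
  - replace (S (S (2 * k))) with (2 * S k) by lia. rewrite agree_even, agree_odd. intros [A B].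
    split; [|exact B]. now rewrite <- (low_low k (S k) s), <- (low_low k (S k) s'), A by lia.
Qed.

Lemma div2_le (i : nat) : Nat.div2 (pred i) <= Nat.div2 i.
Proof.
  destruct i as [|i]; [auto|]. simpl pred. rewrite !Nat.div2_div. apply Nat.Div0.div_le_mono. lia.
Qed.

Lemma agree_rh (i : nat) (s s' t : list N) : chain s -> chain s' -> chain t ->
  agree i s s' -> agree i (rh_mul Sg s t) (rh_mul Sg s' t).
Proof.
  intros Hs Hs' Ht [A B]. split; [now apply low_rh|]. apply nxt_rh_eq; auto.
  pose proof (div2_le i).
  now rewrite <- (low_low _ (Nat.div2 i) s), <- (low_low _ (Nat.div2 i) s'), A.
Qed.

(* [None] is a blank: the chain has no entry of the height in question. *)
Definition admissible (i : nat) (o : option N) : Prop :=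
  match o with
  | None => True
  | Some x =>
      (exists k, i = S (S (2 * k)) /\ hJ x = k /\ x ~H rrep x) \/
      (exists k m y, i = S (2 * S k) /\ hJ m = k /\ x = lrep (Some (iota y) ** m))
  end.

Lemma admissible_even (k : nat) (x : N) :
  admissible (S (S (2 * k))) (Some x) <-> hJ x = k /\ x ~H rrep x.
Proof.
  split; [|intro H; left; exists k; tauto].
  intros [[k' [Ek H]]|[k' [m [y [Ek _]]]]]; [|lia].
  replace k' with k in H by lia. exact H.
Qed.

Lemma admissible_coord (p : nat) (s : list N) : chain s -> admissible (S p) (coord (S p) s).
Proof.
  intro Hs. destruct (parity p) as [k [-> | ->]].
  - rewrite coord_2k1. destruct k as [|k]; [exact Logic.I|]. unfold coord_odd.
    destruct (Nat.eqb_spec (hJ (pre (S k) s)) k) as [Hh|Hh]; [|exact Logic.I].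
    destruct (nxt (S k) s) as [m|] eqn:Em; [|exact Logic.I]. right.
    destruct (nxt_child (S k) s m Hs ltac:(lia) Em) as [y Hy].
    exists k, (rrep (pre (S k) s)), y. split; [reflexivity|]. split; [now rewrite hJ_rrep|].
    apply lrep_eq. rewrite <- to_repE, mulIA. now apply Leq_mulr.
  - rewrite coord_2k2. unfold coord_even.
    destruct (Nat.eqb_spec (hJ (pre (S k) s)) k) as [Hh|Hh]; [|exact Logic.I].
    apply admissible_even. split; [|apply recenter_H]. rewrite (Req_hJ _ _ (recenter_R _)).
    transitivity (hJ (pre (S k) s)); [|exact Hh]. apply Req_hJ, to_rep_R. apply pre_mono; auto.
Qed.

(** * Local maps of the right action *)

Definition local_map_odd (k : nat) (s t : list N) (x : option N) : option N :=
  if dec (pre k s ** hd I t ~R pre k s) then x else coord_odd k (rh_mul Sg s t).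

(** With a = [pre k s] and a' its counterpart in the product, the multiplier given to [transport]
    undoes u_a, applies n and then u_a': it sends m u_a to m n u_a', the new value before
    recentering. *)
Definition local_map_even (k : nat) (s t : list N) (x : option N) : option N :=
  match entry k s with
  | Some m =>
      if dec (m ** hd I t ~R m)
      then option_map (transport (m ** to_rep (pre k s))
             (of_rep (pre k s) ** hd I t ** to_rep (pre k (rh_mul Sg s t)))) x
      else coord_even k (rh_mul Sg s t)
  | None =>
      if dec (pre k s ** hd I t ~R pre k s) then x else coord_even k (rh_mul Sg s t)
  end.

Definition local_map (i : nat) (s t : list N) (x : option N) : option N :=
  if Nat.even i then local_map_even (pred (Nat.div2 i)) s t x else local_map_odd (Nat.div2 i) s t x.

Lemma local_map_2k1 (k : nat) (s t : list N) (x : option N) :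
  local_map (S (2 * k)) s t x = local_map_odd k s t x.
Proof.
  unfold local_map. now rewrite Nat.even_succ, <- Nat.negb_even, Nat.even_even, Nat.div2_succ_double.
Qed.

Lemma local_map_2k2 (k : nat) (s t : list N) (x : option N) :
  local_map (S (S (2 * k))) s t x = local_map_even k s t x.
Proof.
  unfold local_map. replace (S (S (2 * k))) with (2 * S k) by lia.
  now rewrite Nat.even_even, Nat.div2_double.
Qed.

Lemma mul_to_rep (a n m : N) : m <=L a -> a ** n ~R a -> m ** n ** to_rep (a ** n) = m ** to_rep a.
Proof.
  intros [z ->] H. rewrite <- !mulIA, (mulIA a), !to_repE. f_equal. now apply rrep_eq.
Qed.

Lemma coord_local_map (p : nat) (s t : list N) : chain s -> chain t ->
  local_map (S p) s t (coord (S p) s) = coord (S p) (rh_mul Sg s t).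
Proof.
  intros Hs Ht. destruct (parity p) as [k [-> | ->]].
  - rewrite local_map_2k1, !coord_2k1. unfold local_map_odd.
    destruct (dec _) as [HR|]; [|reflexivity].
    destruct k as [|k]; [reflexivity|]. unfold coord_odd.
    rewrite pre_rh_R, (Req_hJ _ _ HR) by auto.
    destruct (hJ (pre (S k) s) =? k); [|reflexivity].
    pose proof (nxt_rh_R (S k) s t Hs Ht) as HL.
    specialize (HL ltac:(lia) HR).
    destruct (nxt (S k) s) as [m|] eqn:Em, (nxt (S k) (rh_mul Sg s t)) as [m'|]; simpl in *; try tauto.
    f_equal. apply lrep_eq. rewrite <- (mul_to_rep _ (hd I t)) by auto using nxt_below.
    now apply Leq_mulr, Leq_sym.
  - rewrite local_map_2k2, !coord_2k2. unfold local_map_even. destruct (entry k s) as [m|] eqn:Em.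
    + apply entry_some in Em as [A [B C]]; auto. destruct (dec _) as [HR|]; [|reflexivity].
      unfold coord_even. rewrite (pre_rh_R (S k)) by (auto; now rewrite C).
      rewrite C, (Req_hJ _ _ HR), B, Nat.eqb_refl. simpl. f_equal.
      rewrite transport_recenter by apply Leq_refl. f_equal. rewrite !mulIA.
      rewrite to_of_rep; auto using nxt_below.
    + apply entry_none in Em; auto. destruct (dec _) as [HR|]; [|reflexivity].
      destruct (pre_blank k s Hs Em) as [C [_ [_ _]]]. unfold coord_even.
      rewrite (pre_rh_R (S k)) by (auto; now rewrite C).
      rewrite C, (Req_hJ _ _ HR), <- C. now destruct (Nat.eqb_spec (hJ (pre (S k) s)) k).
Qed.

Lemma find_last_none_inv (P : N -> bool) (l : list N) :
  find_last P l = None -> forall x, In x l -> P x = false.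
Proof.
  induction l as [|a l IH]; simpl; [tauto|]. destruct (find_last P l); [discriminate|].
  destruct (P a) eqn:Ea; [discriminate|]. intros _ x [<-|Hx]; auto.
Qed.

(** Makes the action well defined on tuples. The R-tests are invariant under L-equivalence, by
    [Req_mulr_L], and the constants of the other branches involve only the part of s fixed by the
    first p coordinates. *)
Lemma local_map_agree (p : nat) (s s' t : list N) (x : option N) : chain s -> chain s' -> chain t ->
  agree p s s' -> local_map (S p) s t x = local_map (S p) s' t x.
Proof.
  intros Hs Hs' Ht HE. destruct (parity p) as [k [-> | ->]].
  - rewrite !local_map_2k1. destruct k as [|k].
    { unfold local_map_odd. replace (pre 0 s') with (pre 0 s); [reflexivity|].
      apply (pre_low_eq 0 0); [auto|]. apply HE. }
    apply agree_even in HE as [A B]. unfold local_map_odd.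
    rewrite <- (pre_low_eq (S k) (S k) s s') by auto. destruct (dec _) as [HR|HR]; [reflexivity|].
    pose proof (low_rh _ _ _ t Hs Hs' Ht A) as A'. unfold coord_odd.
    rewrite <- (pre_low_eq _ _ _ _ (le_n _) A').
    destruct (hJ _ =? k); [|reflexivity].
    assert (HL : oL (nxt (S k) (rh_mul Sg s t)) (nxt (S k) (rh_mul Sg s' t))).
    (* An entry of height k drops here, and its translate is met before [nxt (S k) s], whose L-class
       is not yet known. If there is no such entry, [nxt (S k) s] is the known [nxt k s]. *)
    { destruct (Nat.eq_dec (hJ (pre (S k) s)) k) as [D|D].
      - eapply oL_trans; [now apply nxt_prod|].
        eapply oL_trans; [|apply oL_sym; now apply nxt_prod]. rewrite <- A.
        destruct (nxt (S k) t); [apply oL_refl|].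
        destruct (nxt (S k) (map _ _)) eqn:Ez; [apply oL_refl|]. exfalso.
        pose proof (find_last_none_inv _ _ Ez (pre (S k) s ** hd I t)) as Hz.
        destruct (aboveP (S k) (pre (S k) s ** hd I t)) as [G|G].
        + discriminate Hz. apply in_map_iff. eexists. split; [reflexivity|].
          apply low_In. apply pre_spec; [exact Hs|lia].
        + apply HR. apply hJ_mulr_R. pose proof (hJ_mulr (pre (S k) s) (hd I t)). lia.
      - apply nxt_rh_eq; auto.
        destruct (pre_blank k s Hs D) as [_ [_ [-> _]]].
        destruct (pre_blank k s' Hs') as [_ [_ [-> _]]]; [|exact B].
        now rewrite <- (pre_low_eq (S k) (S k) s s') by auto. }
    destruct (nxt (S k) (rh_mul Sg s t)), (nxt (S k) (rh_mul Sg s' t)); simpl in *; try tauto.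
    f_equal. apply lrep_eq. now apply Leq_mulr.
  - rewrite !local_map_2k2. apply agree_odd in HE as [A B].
    pose proof (low_rh _ _ _ t Hs Hs' Ht A) as A'. pose proof (entry_L _ _ _ B) as C.
    unfold local_map_even. rewrite <- (pre_low_eq k k s s') by auto.
    rewrite <- (pre_low_eq k k (rh_mul Sg s t) (rh_mul Sg s' t)) by auto.
    (* An entry of height k that drops is too deep to be hit below k + 1, so only [low k s]
       matters. *)
    assert (Hc : (forall m, entry k s = Some m -> ~ m ** hd I t ~R m) ->
      coord_even k (rh_mul Sg s t) = coord_even k (rh_mul Sg s' t)).
    { intro Hm. unfold coord_even. rewrite <- (pre_low_eq k k (rh_mul Sg s t) (rh_mul Sg s' t)) by auto.
      assert (Ep : forall u, chain u -> oL (entry k s) (entry k u) ->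
         find (below (S k)) (map (fun x => x ** hd I t) (low (S k) u)) =
         find (below (S k)) (map (fun x => x ** hd I t) (low k u))).
      { intros u Hu Hsu. rewrite low_S by auto.
        destruct (Nat.eqb_spec (hJ (pre (S k) u)) k) as [D|D]; [|reflexivity].
        rewrite (entry_pre k u) in Hsu by auto.
        destruct (entry k s) as [m|] eqn:Em; [|destruct Hsu].
        simpl. destruct (belowP (S k) (pre (S k) u ** hd I t)) as [G|G]; [|reflexivity].
        exfalso. apply (Hm m eq_refl). apply (Req_mulr_L (pre (S k) u)); [apply Hsu|].
        apply hJ_mulr_R. pose proof (hJ_mulr (pre (S k) u) (hd I t)). lia. }
      replace (pre (S k) (rh_mul Sg s' t)) with (pre (S k) (rh_mul Sg s t)); [reflexivity|].
      unfold pre. rewrite !find_rh by auto using below_inv1. rewrite !find_app.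
      rewrite (find_map_low (S k) (S k) _ s), (find_map_low (S k) (S k) _ s') by auto.
      rewrite (Ep s), (Ep s'), A by auto using oL_refl. reflexivity. }
    destruct (entry k s) as [m|], (entry k s') as [m'|]; simpl in C; try tauto.
    + destruct (dec (m ** hd I t ~R m)) as [H|H].
      * destruct (dec _) as [H'|H'].
        -- destruct x as [x|]; [|reflexivity]. simpl. f_equal.
           apply transport_ext; [now apply Leq_mulr|reflexivity].
        -- exfalso. apply H'. apply (Req_mulr_L m); [apply C|exact H].
      * destruct (dec _) as [H'|H'].
        -- exfalso. apply H. apply (Req_mulr_L m'); [apply C|exact H'].
        -- apply Hc. now intros z [= <-].
    + destruct (dec _); [reflexivity|]. now apply Hc.
Qed.

Lemma Req_mul_mul (a n n' : N) : a ** n ~R a ->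
  (a ** n ** n' ~R a ** n <-> a ** (n ** n') ~R a).
Proof.
  intro H. rewrite mulIA. split; intro H'.
  - eapply Req_trans; eassumption.
  - eapply Req_trans; [exact H' | now apply Req_sym].
Qed.

Lemma Req_mul_drop (a n n' : N) : a ** (n ** n') ~R a -> a ** n ~R a.
Proof.
  intros [n1 H]%Req_mulr_inv. apply Req_mulr. exists (n' ** n1). now rewrite !mulIA in *.
Qed.

(** Since x need not be the coordinate of s, [coord_local_map] is not enough. If t drops the
    relevant entry, both sides equal the coordinate of s t u; otherwise the test for u after t
    agrees with that for t u, and translations compose by [transport_comp]. *)
Lemma local_map_comp (p : nat) (s t u : list N) (x : option N) : chain s -> chain t -> chain u ->
  admissible (S p) x ->
  local_map (S p) (rh_mul Sg s t) u (local_map (S p) s t x) = local_map (S p) s (rh_mul Sg t u) x.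
Proof.
  intros Hs Ht Hu HQ. pose proof (coord_local_map p _ _ (chain_rh s t Hs Ht) Hu) as HV.
  rewrite rh_assoc in HV by auto. revert HQ HV.
  destruct (parity p) as [k [-> | ->]].
  - rewrite !local_map_2k1, !coord_2k1. intros _ HV. unfold local_map_odd at 2 3.
    rewrite hd_rh by auto.
    destruct (dec (pre k s ** hd I t ~R pre k s)) as [H|H].
    + unfold local_map_odd. rewrite pre_rh_R, rh_assoc by auto.
      pose proof (Req_mul_mul _ _ (hd I u) H).
      destruct (dec _), (dec _); tauto.
    + rewrite HV. destruct (dec _) as [H'|]; [|reflexivity].
      now apply Req_mul_drop in H'.
  - rewrite !local_map_2k2, !coord_2k2. intros HQ HV. unfold local_map_even at 2 3.
    rewrite hd_rh by auto.
    destruct (entry k s) as [m|] eqn:Em.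
    + apply entry_some in Em as [A [B C]]; auto.
      destruct (dec (m ** hd I t ~R m)) as [H|H].
      * assert (Ep : pre (S k) (rh_mul Sg s t) = m ** hd I t)
          by (rewrite pre_rh_R; rewrite ?C; auto).
        assert (Ec : nxt k (rh_mul Sg s t) = Some (m ** hd I t)).
        { rewrite <- Ep. apply pre_nxt; [now apply chain_rh|]. now rewrite Ep, (Req_hJ _ _ H). }
        unfold local_map_even. unfold entry. rewrite Ec, (Req_hJ _ _ H), B, Nat.eqb_refl.
        rewrite rh_assoc by auto. pose proof (Req_mul_mul _ _ (hd I u) H).
        destruct (dec _), (dec _); try tauto.
        destruct x as [x|]; [|reflexivity]. apply admissible_even in HQ as [_ HQ]. simpl. f_equal.
        set (a := pre k s) in *. set (n := hd I t) in *. set (n' := hd I u) in *.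
        set (a1 := pre k (rh_mul Sg s t)) in *. set (a2 := pre k (rh_mul Sg s (rh_mul Sg t u))).
        assert (Hma : m <=L a) by now apply nxt_below.
        assert (Hma1 : m ** n <=L a1) by (apply nxt_below; auto using chain_rh).
        assert (El : m ** to_rep a ** (of_rep a ** n ** to_rep a1) = m ** n ** to_rep a1).
        { rewrite !mulIA. now rewrite to_of_rep. }
        rewrite <- El, transport_comp.
        -- apply transport_ext; [apply Leq_refl|]. rewrite !mulIA.
           rewrite (to_of_rep a m) by auto. rewrite (to_of_rep a1) by auto. reflexivity.
        -- rewrite El. eapply Req_trans; [now apply to_rep_R|].
           eapply Req_trans; [exact H|]. apply Req_sym. now apply to_rep_R.
        -- exact HQ.
      * rewrite HV. destruct (dec _) as [H'|]; [|reflexivity].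
        now apply Req_mul_drop in H'.
    + apply entry_none in Em; auto. destruct (pre_blank k s Hs Em) as [C _].
      destruct (dec (pre k s ** hd I t ~R pre k s)) as [H|H].
      * unfold local_map_even. replace (entry k (rh_mul Sg s t)) with (@None N).
        2:{ symmetry. apply entry_none; [now apply chain_rh|].
            rewrite pre_rh_R by (auto; now rewrite C). rewrite C, (Req_hJ _ _ H), <- C. exact Em. }
        rewrite pre_rh_R, rh_assoc by auto.
        pose proof (Req_mul_mul _ _ (hd I u) H).
        destruct (dec _), (dec _); tauto.
      * rewrite HV. destruct (dec _) as [H'|]; [|reflexivity].
        now apply Req_mul_drop in H'.
Qed.

Lemma local_map_odd_cases (k : nat) (s t : list N) :
  (forall x, local_map_odd k s t x = x) \/ (exists c, forall x, local_map_odd k s t x = c).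
Proof. unfold local_map_odd. destruct (dec _); eauto. Qed.

(** The dichotomy behind (ii) and (iii): outside the constant case the map is an element of the
    direct sum, and [pre (S k) s] keeps its R-class, which is what [local_map_deep_id] asks for. *)
Lemma local_map_even_cases (k : nat) (s t : list N) : chain s -> chain t ->
  (exists c, forall x, local_map_even k s t x = c) \/
  pre (S k) s ** hd I t ~R pre (S k) s /\
  exists (v : N -> N) (L : list N),
    (forall x, admissible (S (S (2 * k))) x -> local_map_even k s t x = option_map (fun x => x ** v (rrep x)) x) /\
    (forall x, admissible (S (S (2 * k))) (Some x) -> x ** v (rrep x) ~H x) /\
    (forall r, rrep r = r -> ~ In r L -> v r = I).
Proof.
  intros Hs Ht. unfold local_map_even. destruct (entry k s) as [m|] eqn:Em.
  - apply entry_some in Em as [A [B C]]; auto. destruct (dec _) as [H|H]; [|eauto]. right.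
    rewrite C. split; [exact H|].
    set (a := pre k s) in *. set (n := hd I t) in *.
    set (a1 := pre k (rh_mul Sg s t)) in *.
    assert (Hma : m <=L a) by now apply nxt_below.
    assert (Ep : pre (S k) (rh_mul Sg s t) = m ** n) by (unfold n; rewrite pre_rh_R; rewrite ?C; auto).
    assert (Hma1 : m ** n <=L a1).
    { rewrite <- Ep. apply pre_mono; auto using chain_rh. }
    assert (El : m ** to_rep a ** (of_rep a ** n ** to_rep a1) = m ** n ** to_rep a1).
    { rewrite !mulIA. now rewrite to_of_rep. }
    destruct (transport_translation (m ** to_rep a) (of_rep a ** n ** to_rep a1)) as [v [L [V1 [V2 V3]]]].
    { rewrite El. eapply Req_trans; [now apply to_rep_R|].
      eapply Req_trans; [exact H|]. apply Req_sym. now apply to_rep_R. }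
    exists v, L. split; [|split; [|exact V3]].
    + intros [x|] Hx; [|reflexivity]. apply admissible_even in Hx as [_ Hx]. simpl. f_equal. auto.
    + intros x Hx. apply admissible_even in Hx as [_ Hx]. rewrite <- V1 by auto. auto.
  - destruct (dec _) as [H|H]; [|eauto]. right. apply entry_none in Em; auto.
    destruct (pre_blank k s Hs Em) as [C _]. rewrite C. split; [exact H|].
    exists (fun _ => I), []. split; [|split; [|reflexivity]].
    + intros [x|] _; simpl; [now rewrite mulI1|reflexivity].
    + intros x _. rewrite mulI1. apply Heq_refl.
Qed.

Lemma local_map_admissible (p : nat) (s t : list N) (x : option N) : chain s -> chain t ->
  admissible (S p) x -> admissible (S p) (local_map (S p) s t x).
Proof.
  intros Hs Ht Hx. destruct (parity p) as [k [-> | ->]].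
  - rewrite local_map_2k1. unfold local_map_odd. destruct (dec _); [exact Hx|].
    rewrite <- coord_2k1. now apply admissible_coord, chain_rh.
  - rewrite local_map_2k2.
    destruct (local_map_even_cases k s t Hs Ht) as [[c Hc]|[_ [v [L [V1 [V2 _]]]]]].
    + rewrite Hc, <- (Hc (coord_even k s)), <- local_map_2k2, <- coord_2k2, coord_local_map by auto.
      now apply admissible_coord, chain_rh.
    + rewrite V1 by auto. destruct x as [x|]; [|exact Logic.I].
      apply V2 in Hx as HH. apply admissible_even in Hx as [A B]. apply admissible_even. split.
      * rewrite <- A. apply Leq_hJ, HH.
      * eapply Heq_trans; [exact HH|]. eapply Heq_trans; [exact B|].
        rewrite (rrep_eq _ _ (proj2 HH)). apply Heq_refl.
Qed.

(* An R-class preserved by the acting element freezes all deeper coordinates. *)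
Lemma local_map_deep_id (j p : nat) (s t : list N) (x : option N) : chain s -> chain t ->
  pre j s ** hd I t ~R pre j s -> 2 * j <= p -> local_map (S p) s t x = x.
Proof.
  intros Hs Ht HR Hp.
  assert (Hpre : forall k, j <= k -> pre k s ** hd I t ~R pre k s).
  { intros k Hk. apply (Req_mulr_L (pre j s)); [now apply pre_mono|exact HR]. }
  destruct (parity p) as [k [-> | ->]].
  - rewrite local_map_2k1. unfold local_map_odd. destruct (dec _) as [|H]; [reflexivity|].
    exfalso. apply H, Hpre. lia.
  - rewrite local_map_2k2. unfold local_map_even. specialize (Hpre k ltac:(lia)).
    destruct (entry k s) as [m|] eqn:Em.
    + apply entry_some in Em as [A _]; auto. apply nxt_below in A; auto.
      destruct (dec _) as [H|H].
      (* The translation sends m u_a to m n u_(an), which is m u_a again by [mul_to_rep]. *)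
      * destruct x as [x|]; [|reflexivity]. simpl. f_equal. apply transport_id.
        rewrite pre_rh_R by auto. rewrite !mulIA, to_of_rep by auto. now apply mul_to_rep.
      * exfalso. apply H. now apply (Req_mulr_L (pre k s)).
    + destruct (dec _); [reflexivity|contradiction].
Qed.

(** * The action on tuples of coordinates *)

Definition level (i : nat) : Type := {o : option N | admissible i o}.

Lemma level_ext (i : nat) (x x' : level i) : proj1_sig x = proj1_sig x' -> x = x'.
Proof.
  destruct x as [o q], x' as [o' q']. simpl. intros ->. f_equal. apply proof_irrelevance.
Qed.

Definition to_level (i : nat) (o : option N) : level i :=
  match dec (admissible i o) with
  | left q => exist _ o q
  | right _ => exist (admissible i) None Logic.I
  end.

Lemma to_level_val (i : nat) (o : option N) : admissible i o -> proj1_sig (to_level i o) = o.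
Proof. intro H. unfold to_level. now destruct (dec _). Qed.

Lemma to_level_proj (i : nat) (x : level i) : to_level i (proj1_sig x) = x.
Proof. apply level_ext, to_level_val, proj2_sig. Qed.

Fixpoint encode (s : list N) (i : nat) : tup level i :=
  match i with
  | 0 => tt
  | S p => (to_level (S p) (coord (S p) s), encode s p)
  end.

(** Only the tail must encode a chain; the leading component is free in its level, so a nonempty
    local map is total. The identity chain is set apart because it must also fix the tuples that
    encode no chain. *)
Definition phi (t : list N) : seqmap level := fun i =>
  if dec (t = rh_one Sg) then fun u => Some u
  else match i with
  | 0 => fun u => Some u
  | S p => fun u =>
      match dec (exists s, chain s /\ encode s p = snd u) with
      | left _ =>
          let s := epsilon (inhabits []) (fun s => chain s /\ encode s p = snd u) in
          Some (to_level (S p) (local_map (S p) s t (proj1_sig (fst u))), encode (rh_mul Sg s t) p)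
      | right _ => None
      end
  end.

Lemma encode_agree (i : nat) (s s' : list N) :
  chain s -> chain s' -> encode s i = encode s' i -> agree i s s'.
Proof.
  intros Hs Hs'. induction i as [|p IH]; [intro; now apply agree_0|].
  simpl. intros [= A B]. apply agree_step; auto.
  rewrite <- (to_level_val (S p) (coord (S p) s)), <- (to_level_val (S p) (coord (S p) s')) by now apply admissible_coord.
  now rewrite A.
Qed.

Lemma agree_encode (i : nat) (s s' : list N) :
  chain s -> chain s' -> agree i s s' -> encode s i = encode s' i.
Proof.
  intros Hs Hs'. induction i as [|p IH]; [reflexivity|]. intro HE. simpl.
  rewrite (coord_agree _ _ _ HE). f_equal. now apply IH, agree_pred.
Qed.

Lemma encode_rh (i : nat) (s s' t : list N) : chain s -> chain s' -> chain t ->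
  encode s i = encode s' i -> encode (rh_mul Sg s t) i = encode (rh_mul Sg s' t) i.
Proof.
  intros Hs Hs' Ht H. apply agree_encode; auto using chain_rh. now apply agree_rh, encode_agree.
Qed.

Lemma phi_one (i : nat) (u : tup level i) : phi (rh_one Sg) i u = Some u.
Proof. unfold phi. destruct (dec _) as [|H]; [reflexivity|now destruct H]. Qed.

Lemma phi_0 (t : list N) (u : tup level 0) : phi t 0 u = Some u.
Proof. unfold phi. now destruct (dec _). Qed.

(** The chain chosen by epsilon may be replaced by any s with the same code, by [local_map_agree]
    and [encode_rh]. *)
Lemma phi_S (t s : list N) (p : nat) (x : level (S p)) : chain t -> chain s -> t <> rh_one Sg ->
  phi t (S p) ((x, encode s p) : tup level (S p)) =
  Some ((to_level (S p) (local_map (S p) s t (proj1_sig x)), encode (rh_mul Sg s t) p) : tup level (S p)).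
Proof.
  intros Ht Hs Hne. unfold phi. destruct (dec (t = _)); [contradiction|]. simpl.
  destruct (dec _) as [Hex|H]; [|destruct H; now exists s].
  apply (epsilon_spec (inhabits [])) in Hex as [A B]. f_equal. f_equal.
  - f_equal. apply local_map_agree; auto. now apply encode_agree.
  - now apply encode_rh.
Qed.

Lemma phi_invalid (t : list N) (p : nat) (u : tup level (S p)) : t <> rh_one Sg ->
  ~ (exists s, chain s /\ encode s p = snd u) -> phi t (S p) u = None.
Proof.
  intros Hne H. unfold phi. destruct (dec (t = _)); [contradiction|]. now destruct (dec _).
Qed.

Lemma phi_encode (t s : list N) (i : nat) : chain t -> chain s ->
  phi t i (encode s i) = Some (encode (rh_mul Sg s t) i).
Proof.
  intros Ht Hs. destruct (dec (t = rh_one Sg)) as [->|Hne]; [now rewrite phi_one, rh_1r|].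
  destruct i as [|p]; [now rewrite phi_0|]. simpl. rewrite phi_S by auto.
  now rewrite to_level_val, coord_local_map by auto using admissible_coord.
Qed.

Lemma phi_mul (t t' : list N) (i : nat) (u : tup level i) : chain t -> chain t' ->
  phi (rh_mul Sg t t') i u = sq_comp level (phi t) (phi t') i u.
Proof.
  intros Ht Ht'. unfold sq_comp.
  destruct (dec (t = rh_one Sg)) as [->|Hne]; [now rewrite phi_one, rh_1l|].
  destruct (dec (t' = rh_one Sg)) as [->|Hne'].
  { rewrite rh_1r by auto. destruct (phi t i u); [now rewrite phi_one|reflexivity]. }
  assert (Hm : rh_mul Sg t t' <> rh_one Sg) by (intro H; now apply rh_not_one in H).
  destruct i as [|p]; [now rewrite !phi_0|].
  destruct (classic (exists s, chain s /\ encode s p = snd u)) as [[s [Hs Eu]]|H].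
  - destruct u as [x u]. simpl in *. subst u.
    rewrite !phi_S by auto using chain_rh. rewrite rh_assoc by auto.
    rewrite to_level_val by (apply local_map_admissible; auto; apply proj2_sig).
    now rewrite local_map_comp by (auto; apply proj2_sig).
  - now rewrite !phi_invalid.
Qed.

Lemma drop_encode (s : list N) (n j : nat) : drop level n j (encode s (n + j)) = encode s j.
Proof. induction n as [|n IH]; [reflexivity|]. exact IH. Qed.

Lemma phi_drop_1 (t : list N) (p : nat) (u w : tup level (S p)) : chain t ->
  phi t (S p) u = Some w -> phi t p (snd u) = Some (snd w).
Proof.
  intros Ht. destruct (dec (t = rh_one Sg)) as [->|Hne].
  { rewrite !phi_one. now intros [= ->]. }
  destruct (classic (exists s, chain s /\ encode s p = snd u)) as [[s [Hs Eu]]|H].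
  - destruct u as [x u]. simpl in Eu. subst u. rewrite phi_S by auto. intros [= <-].
    now apply phi_encode.
  - now rewrite phi_invalid.
Qed.

Lemma phi_drop (t : list N) (n j : nat) (u w : tup level (n + j)) : chain t ->
  phi t (n + j) u = Some w -> phi t j (drop level n j u) = Some (drop level n j w).
Proof.
  intro Ht. induction n as [|n IH]; [auto|]. intro H. apply IH. now apply phi_drop_1.
Qed.

(** Acting on the code of the identity chain returns the code of s. Level 2(h + 1), with h the
    larger height of the two leftmost terms, lies within delta and shows both chains completely. *)
Lemma phi_inj (s s' : list N) : chain s -> chain s' ->
  (forall i (t : tup level i), in_range Sg i -> phi s i t = phi s' i t) -> s = s'.
Proof.
  assert (H : forall s s', chain s -> chain s' -> hJ (hd I s) <= hJ (hd I s') ->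
    (forall i (t : tup level i), in_range Sg i -> phi s i t = phi s' i t) -> s = s').
  { clear s s'. intros s s' Hs Hs' Hh H. set (k := hJ (hd I s')) in *.
    assert (Hr : in_range Sg (2 * S k)).
    { split; [lia|]. unfold k. destruct (hd I s') as [m|] eqn:Em.
      - right. exists m, (hJ (Some m)). split; [apply hJP | lia].
      - left. change (2 * S (hJ I) <= 2). now rewrite hJ_I. }
    specialize (H _ (encode (rh_one Sg) (2 * S k)) Hr).
    rewrite !phi_encode, !rh_1l in H by auto using chain_one.
    assert (He : encode s (2 * S k) = encode s' (2 * S k)) by congruence.
    apply encode_agree, agree_even in He as [He _]; auto.
    rewrite <- (low_full (S k) s), <- (low_full (S k) s') by (auto; fold k; lia). exact He. }
  intros Hs Hs' Hphi. destruct (le_ge_dec (hJ (hd I s)) (hJ (hd I s'))).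
  - now apply H.
  - symmetry. apply H; auto. intros. symmetry. auto.
Qed.

Lemma loc_one (p : nat) (u : tup level p) : loc level (phi (rh_one Sg)) p u = pid (level (S p)).
Proof. apply functional_extensionality. intro x. unfold loc. now rewrite phi_one. Qed.

Lemma loc_encode (t s : list N) (p : nat) : chain t -> chain s -> t <> rh_one Sg ->
  loc level (phi t) p (encode s p) = fun x => Some (to_level (S p) (local_map (S p) s t (proj1_sig x))).
Proof.
  intros. apply functional_extensionality. intro x. unfold loc. now rewrite phi_S.
Qed.

Lemma loc_invalid (t : list N) (p : nat) (u : tup level p) : t <> rh_one Sg ->
  ~ (exists s, chain s /\ encode s p = u) -> loc level (phi t) p u = fun _ => None.
Proof.
  intros Hne H. apply functional_extensionality. intro x. unfold loc. now rewrite phi_invalid.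
Qed.

(** A chain r encoding t' also encodes t. A local map outside K then means that [pre (S k) r] keeps
    its R-class, which freezes the deeper levels. *)
Lemma phi_zeiger (s : list N) (k : nat) (t : tup level (S (2 * k))) : chain s ->
  ~ isK (level (S (S (2 * k)))) (loc level (phi s) (S (2 * k)) t) ->
  forall n (t' : tup level (n + S (2 * k))), 1 <= n -> drop level n (S (2 * k)) t' = t ->
  restr_id (level (S (n + S (2 * k)))) (loc level (phi s) (n + S (2 * k)) t').
Proof.
  intros Hs HK n t' Hn Ht. destruct (dec (s = rh_one Sg)) as [->|Hne].
  { rewrite loc_one. intros x y [= <-]. reflexivity. }
  destruct (classic (exists r, chain r /\ encode r (n + S (2 * k)) = t')) as [[r [Hr Er]]|H].
  2:{ rewrite loc_invalid by auto. intros x y [=]. }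
  subst t'. rewrite drop_encode in Ht. subst t. rewrite loc_encode in * by auto.
  destruct (local_map_even_cases k r s Hr Hs) as [[c Hc]|[HR _]].
  - exfalso. apply HK. intros x x' y y'. rewrite !local_map_2k2, !Hc. congruence.
  - intros x y. rewrite (local_map_deep_id (S k)) by (auto; lia). rewrite to_level_proj. congruence.
Qed.

Lemma level_finite (i : nat) : finite_type Y -> finite_type (level i).
Proof.
  intros FY. destruct (finite_level i FY) as [l Hl]. destruct FY as [lY HlY].
  exists (map (to_level i) (None :: map Some l ++
    map Some (flat_map (fun m => map (fun y => lrep (Some (iota y) ** m)) lY) l))).
  intro x. rewrite <- (to_level_proj i x). apply in_map.
  destruct x as [[x|] H]; simpl; [right|now left]. apply in_or_app.
  destruct H as [[k [Hi [Hk _]]]|[k [m [y [Hi [Hk ->]]]]]]; [left|right]; apply in_map.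
  - apply Hl. lia.
  - apply in_flat_map. exists m. split; [apply Hl; lia|]. apply in_map_iff. now exists y.
Qed.

(** An element of the direct sum of Schutzenberger groups in right-handed form: a multiplier v r for
    each R-representative r, stabilising the H-class of r and trivial off a finite list. *)
Definition GroupPart (i : nat) (f : level i -> option (level i)) : Prop :=
  exists (v : N -> N) (L : list N),
    (forall x, f x = Some (to_level i (option_map (fun z => z ** v (rrep z)) (proj1_sig x)))) /\
    (forall z, admissible i (Some z) -> z ** v (rrep z) ~H z) /\
    (forall r, rrep r = r -> ~ In r L -> v r = I).

(** Not generated by the local maps of [phi]: all of K is included, together with the identity or
    with the full direct sum. Closure is then direct and the group of permutations is known
    exactly. *)
Definition Mi (i : nat) (f : level i -> option (level i)) : Prop :=
  (forall k, i = S (2 * k) -> f = pid (level i) \/ isK (level i) f) /\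
  (forall k, i = S (S (2 * k)) -> GroupPart i f \/ isK (level i) f).

Lemma Mi_odd (k : nat) (f : level (S (2 * k)) -> option (level (S (2 * k)))) :
  Mi (S (2 * k)) f <-> f = pid _ \/ isK _ f.
Proof.
  split; [intros [H _]; now apply (H k)|]. intro H. split; [auto|]. intros k' E'. lia.
Qed.

Lemma Mi_even (k : nat) (f : level (S (S (2 * k))) -> option (level (S (S (2 * k))))) :
  Mi (S (S (2 * k))) f <-> GroupPart _ f \/ isK _ f.
Proof.
  split; [intros [_ H]; now apply (H k)|]. intro H. split; [|auto]. intros k' E'. lia.
Qed.

Lemma isK_comp_r (T : Type) (f g : T -> option T) : isK T g -> isK T (pcomp T f g).
Proof.
  intros H x x' y y'. unfold pcomp. destruct (f x), (f x'); try discriminate. apply H.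
Qed.

Lemma isK_comp_l (T : Type) (f g : T -> option T) : isK T f -> isK T (pcomp T f g).
Proof.
  intros H x x' y y'. unfold pcomp. destruct (f x) eqn:E1, (f x') eqn:E2; try discriminate.
  rewrite (H _ _ _ _ E1 E2). congruence.
Qed.

Lemma GroupPart_pid (i : nat) : GroupPart i (pid (level i)).
Proof.
  exists (fun _ => I), []. split; [|split; [|reflexivity]].
  - intro x. unfold pid. f_equal. rewrite <- (to_level_proj i x) at 1. f_equal.
    destruct (proj1_sig x); simpl; [now rewrite mulI1|reflexivity].
  - intros z _. rewrite mulI1. apply Heq_refl.
Qed.

Lemma admissible_mulr_H (k : nat) (z z' : N) :
  admissible (S (S (2 * k))) (Some z) -> z' ~H z -> admissible (S (S (2 * k))) (Some z') /\ rrep z' = rrep z.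
Proof.
  rewrite !admissible_even. intros [A B] H. assert (Er : rrep z' = rrep z) by apply rrep_eq, H.
  split; [|exact Er]. split; [rewrite <- A; apply Leq_hJ, H|].
  rewrite Er. eapply Heq_trans; eassumption.
Qed.

Lemma GroupPart_comp (k : nat) f g :
  GroupPart (S (S (2 * k))) f -> GroupPart (S (S (2 * k))) g ->
  GroupPart (S (S (2 * k))) (pcomp _ f g).
Proof.
  intros [v [L [F1 [F2 F3]]]] [w [L' [G1 [G2 G3]]]].
  exists (fun r => v r ** w r), (L ++ L'). split; [|split].
  - intros [[z|] q]; unfold pcomp; rewrite F1, G1; f_equal; f_equal.
    + simpl. destruct (admissible_mulr_H k z _ q (F2 z q)) as [A B].
      rewrite to_level_val by exact A. simpl. now rewrite B, mulIA.
    + simpl. now rewrite to_level_val.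
  - intros z q. destruct (admissible_mulr_H k z _ q (F2 z q)) as [A B].
    rewrite mulIA. eapply Heq_trans; [|apply F2, q].
    pose proof (G2 _ A) as C. now rewrite B in C.
  - intros r Hr Hin. rewrite in_app_iff in Hin. rewrite F3, G3 by tauto. reflexivity.
Qed.

Lemma GroupPart_perm (k : nat) f : GroupPart (S (S (2 * k))) f -> isPerm _ f.
Proof.
  intros [v [L [F1 [F2 _]]]]. split; [|split].
  - intro x. eexists. apply F1.
  - intros [[z|] q] [[z'|] q'] y; rewrite !F1; intros Ey E'; apply level_ext; rewrite <- Ey in E'; clear Ey;
      apply (f_equal (fun o => match o with Some w => proj1_sig w | None => None end)) in E';
      simpl in E' |- *.
    + destruct (admissible_mulr_H k z _ q (F2 z q)) as [A B], (admissible_mulr_H k z' _ q' (F2 z' q')) as [A' B'].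
      rewrite !to_level_val in E' by assumption. injection E' as E'.
      assert (Er : rrep z = rrep z') by (rewrite <- B, <- B'; now f_equal).
      rewrite <- Er in E'. destruct (Req_mulr_inv _ _ (proj2 (F2 z q))) as [n Hn].
      apply admissible_even in q as [_ q], q' as [_ q'].
      assert (Ez' : z' ** v (rrep z) ** n = z').
      { rewrite <- mulIA. rewrite <- (mulI1 z') at 2. apply (L_mul_eq z).
        - eapply Lle_trans; [apply q'|]. rewrite <- Er. apply q.
        - now rewrite mulIA, mulI1. }
      congruence.
    + destruct (admissible_mulr_H k z _ q (F2 z q)) as [A _]. rewrite !to_level_val in E' by easy.
      discriminate.
    + destruct (admissible_mulr_H k z' _ q' (F2 z' q')) as [A _].
      rewrite !to_level_val in E' by easy. discriminate.
    + reflexivity.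
  - intros [[z|] q].
    + set (r := rrep z). apply admissible_even in q as q0. destruct q0 as [Hk Hz].
      assert (Qr : admissible (S (S (2 * k))) (Some r)).
      { apply (admissible_mulr_H k z); [exact q|]. apply Heq_sym, Hz. }
      assert (Er : rrep r = r) by apply rrep_idem.
      pose proof (F2 r Qr) as Hr. rewrite Er in Hr.
      destruct (Req_mulr_inv _ _ (proj2 Hr)) as [n Hn].
      (* At r, n undoes v r on the right; it also does so on the left because r is a left multiple
         of r v r. *)
      assert (Hrn : r ** n ** v r = r).
      { destruct (proj2 (proj1 Hr)) as [p Hp]. rewrite Hp at 1.
        rewrite <- mulIA. rewrite <- (mulIA p). rewrite (mulIA _ n), Hn. now rewrite <- Hp. }
      assert (Hzn : z ** n ** v r = z).
      { rewrite <- mulIA. rewrite <- (mulI1 z) at 2. apply (L_mul_eq r); [apply Hz|].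
        now rewrite mulIA, mulI1. }
      assert (HH : z ** n ~H z).
      { split; [|apply Req_mulr; now exists (v r)].
        eapply Leq_trans; [apply Leq_mulr, Hz|]. apply Leq_sym.
        eapply Leq_trans; [apply Hz|].
        eapply Leq_trans; [|apply Leq_mulr, Hr]. fold r. rewrite Hn. apply Leq_refl. }
      destruct (admissible_mulr_H k z _ q HH) as [A B].
      exists (to_level _ (Some (z ** n))). rewrite F1, to_level_val by exact A. f_equal. simpl.
      rewrite B. fold r. rewrite Hzn. apply level_ext. now rewrite to_level_val.
    + exists (exist (admissible _) None q). rewrite F1. simpl. f_equal. apply level_ext.
      now rewrite to_level_val.
Qed.

(** A permutation with at most one value lives on at most one point. Hence adding K to the direct
    sum creates no new permutation. *)
Lemma isK_perm (T : Type) (f : T -> option T) : isK T f -> isPerm T f -> f = pid T.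
Proof.
  intros HK [H1 [H2 _]]. apply functional_extensionality. intro x.
  destruct (H1 x) as [y Hy]. rewrite Hy. unfold pid. f_equal.
  destruct (H1 y) as [z Hz]. rewrite (HK _ _ _ _ Hy Hz) in Hy. symmetry. now apply (H2 x y z).
Qed.

Lemma Mi_perm (k : nat) f :
  Mi (S (S (2 * k))) f /\ isPerm _ f <-> GroupPart (S (S (2 * k))) f.
Proof.
  rewrite Mi_even. split.
  - intros [[H|H] HP]; [exact H|]. rewrite (isK_perm _ _ H HP). apply GroupPart_pid.
  - intro H. split; [now left|]. now apply (GroupPart_perm k).
Qed.

Lemma Mi_submonoid (p : nat) : submonoidP (level (S p)) (Mi (S p)).
Proof.
  destruct (parity p) as [k [-> | ->]].
  - split; [rewrite Mi_odd; now left|]. intros f g. rewrite !Mi_odd.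
    intros [-> |Hf]; [tauto|]. intros _. right. now apply isK_comp_l.
  - split; [rewrite Mi_even; left; apply GroupPart_pid|]. intros f g. rewrite !Mi_even.
    intros [Hf|Hf] [Hg|Hg]; [left; now apply GroupPart_comp | right..];
      auto using isK_comp_l, isK_comp_r.
Qed.

Lemma isK_const (T : Type) (c : option T) : isK T (fun _ => c).
Proof. intros x x' y y'. congruence. Qed.

Lemma Mi_loc (t : list N) (p : nat) (u : tup level p) : chain t -> Mi (S p) (loc level (phi t) p u).
Proof.
  intro Ht. destruct (dec (t = rh_one Sg)) as [->|Hne].
  { rewrite loc_one. apply Mi_submonoid. }
  destruct (classic (exists s, chain s /\ encode s p = u)) as [[s [Hs <-]]|H].
  2:{ rewrite loc_invalid by auto. split; intros; right; apply isK_const. }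
  rewrite loc_encode by auto. destruct (parity p) as [k [-> | ->]].
  - apply Mi_odd. destruct (local_map_odd_cases k s t) as [H|[c H]].
    + left. apply functional_extensionality. intro x. now rewrite local_map_2k1, H, to_level_proj.
    + right. intros x x' y y'. rewrite !local_map_2k1, !H. congruence.
  - apply Mi_even. destruct (local_map_even_cases k s t Hs Ht) as [[c H]|[_ [v [L [V1 [V2 V3]]]]]].
    + right. intros x x' y y'. rewrite !local_map_2k2, !H. congruence.
    + left. exists v, L. split; [|split; [exact V2|exact V3]].
      intro x. rewrite local_map_2k2, V1 by apply proj2_sig. reflexivity.
Qed.

Lemma phi_wreath (t : list N) : chain t -> in_wreath level (in_range Sg) Mi (phi t).
Proof.
  intro Ht. split; [|split].
  - intros p x u _ _ H. destruct (phi t (S p) _) as [w|] eqn:Ew; [|contradiction].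
    apply phi_drop_1 in Ew; [|exact Ht]. simpl in Ew. now rewrite Ew.
  - intros j n n' u u' w w' _ _ Hd Hw Hw'.
    apply phi_drop in Hw, Hw'; auto. rewrite Hd in Hw. congruence.
  - intros. now apply Mi_loc.
Qed.

(** * The group part of the even levels *)

Lemma Rclass_ext (lam : N -> Prop) (x : N) : is_Rclass Sg lam -> lam x -> lam = Rclass Sg x.
Proof.
  intros [m Hm] Hx. apply functional_extensionality. intro z. apply propositional_extensionality.
  rewrite Hm. unfold Rclass. apply Hm in Hx.
  split; intro H; (eapply Req_trans; [exact H|]); [now apply Req_sym|exact Hx].
Qed.

Lemma is_Rclass_R (lam : N -> Prop) (x z : N) : is_Rclass Sg lam -> lam x -> z ~R x -> lam z.
Proof. intros Hl Hx Hz. rewrite (Rclass_ext lam x Hl Hx). exact Hz. Qed.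

Lemma is_Rclass_Req (lam : N -> Prop) (x z : N) : is_Rclass Sg lam -> lam x -> lam z -> z ~R x.
Proof. intros Hl Hx Hz. now rewrite (Rclass_ext lam x Hl Hx) in Hz. Qed.

(** Writing h = m z carries the L-relation from m to h, and stability supplies the R-relation. So
    the H-class used to define [GR] may be any one in the R-class. *)
Lemma mull_H (s m h : N) : s ** m ~H m -> h ~R m -> s ** h ~H h.
Proof.
  intros Hs Hh. destruct (proj1 Hh) as [z ->].
  assert (HL : s ** (m ** z) ~L m ** z) by (rewrite mulIA; apply Leq_mulr, Hs).
  split; [exact HL|]. apply hJ_Req; [|now apply Leq_hJ].
  rewrite mulIA. eapply Rle_trans; [now exists z|].
  eapply Rle_trans; [apply Hs | apply Hh].
Qed.

Lemma GR_intro (lam : N -> Prop) (g : N -> N) (m s : N) :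
  is_Rclass Sg lam -> lam m -> s ** m ~H m ->
  (forall x, lam x -> g x = s ** x) -> (forall x, ~ lam x -> g x = x) -> GR Sg lam g.
Proof.
  intros Hl Hm Hs Hin Hout. exists m. split; [exact Hm|]. exists s. split; [|now split].
  intros h Hh. eapply Heq_trans; [apply (mull_H s m h Hs), Hh | exact Hh].
Qed.

Lemma GR_elim (lam : N -> Prop) (g : N -> N) : is_Rclass Sg lam -> GR Sg lam g ->
  exists m s, lam m /\ (forall x, lam x -> s ** x ~H x /\ g x = s ** x) /\
    (forall x, ~ lam x -> g x = x).
Proof.
  intros Hl [m [Hm [s [Hs [Hin Hout]]]]]. exists m, s. split; [exact Hm|]. split; [|exact Hout].
  intros x Hx. split; [|now apply Hin]. apply (mull_H s m); [apply Hs, Heq_refl|].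
  now apply (is_Rclass_Req lam).
Qed.

Lemma GR_group (lam : N -> Prop) : is_Rclass Sg lam -> is_subgroup Sg lam (GR Sg lam).
Proof.
  intro Hl. split; [auto|]. split; [|split].
  - destruct Hl as [m Hm]. apply (GR_intro lam _ m I); auto.
    + now exists m.
    + apply Hm, Req_refl.
    + apply Heq_refl.
  - intros g g' Hg Hg'. apply GR_elim in Hg as [m [s [Hm [Hs Ho]]]]; auto.
    apply GR_elim in Hg' as [_ [s' [_ [Hs' Ho']]]]; auto.
    assert (Hlam : forall x, lam x -> lam (s' ** x)).
    { intros x Hx. apply (is_Rclass_R lam x); auto. apply Hs', Hx. }
    apply (GR_intro lam _ m (s ** s')); auto.
    + rewrite <- mulIA. eapply Heq_trans; [apply Hs, Hlam, Hm | apply Hs', Hm].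
    + intros x Hx. rewrite (proj2 (Hs' x Hx)), <- mulIA. apply Hs, Hlam, Hx.
    + intros x Hx. rewrite Ho'; auto.
  - intros g Hg. apply GR_elim in Hg as [m [s [Hm [Hs Ho]]]]; auto.
    destruct (Hs m Hm) as [[[_ [t Ht]] [_ [p Hp]]] _].
    (* From m = t s m and m = s m p follow t m = m p and s t m = m, so left translation by t is the
       inverse. *)
    assert (Etm : t ** m = m ** p).
    { rewrite Hp at 1. rewrite mulIA. now rewrite <- Ht. }
    assert (Estm : s ** (t ** m) = m) by (now rewrite Etm, mulIA).
    assert (HL : t ** m ~L m) by (split; [now exists t | now exists s]).
    assert (HH : t ** m ~H m).
    { split; [exact HL|]. apply hJ_Req; [rewrite Etm; now exists p | now apply Leq_hJ]. }
    assert (Hlam : forall x, lam x -> lam (t ** x)).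
    { intros x Hx. apply (is_Rclass_R lam x); auto. apply (mull_H t m); auto.
      now apply (is_Rclass_Req lam). }
    exists (fun x => if dec (lam x) then t ** x else x). split.
    + apply (GR_intro lam _ m t); auto; intros x Hx; destruct (dec _); tauto.
    + intro x. destruct (dec (lam x)) as [Hx|Hx]; [|now apply Ho].
      rewrite (proj2 (Hs _ (Hlam x Hx))).
      destruct (proj1 (is_Rclass_Req lam m x Hl Hm Hx)) as [z ->].
      rewrite (mulIA t), (mulIA s). now rewrite Estm.
Qed.

Definition rep_image (k : nat) (f : level (S (S (2 * k))) -> option (level (S (S (2 * k))))) (r : N) : N :=
  match f (to_level _ (Some r)) with
  | Some y => match proj1_sig y with Some z => z | None => r end
  | None => r
  end.

(* A group-part map sends the representative r of lam to s ** r for some s; psi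
   records the left translation by s on lam. *)
Definition psi (k : nat) (f : level (S (S (2 * k))) -> option (level (S (S (2 * k)))))
    (lam : N -> Prop) (x : N) : N :=
  if dec (is_Rclass Sg lam /\ lam x /\ hJ x = k)
  then epsilon (inhabits I) (fun s => s ** rrep x = rep_image k f (rrep x)) ** x
  else x.

Lemma admissible_rep (k : nat) (x : N) : hJ x = k -> admissible (S (S (2 * k))) (Some (rrep x)).
Proof.
  intro H. apply admissible_even. rewrite hJ_rrep, rrep_idem. split; [exact H|apply Heq_refl].
Qed.

Lemma rep_image_eq (k : nat) f (v : N -> N) (x : N) :
  (forall x, f x = Some (to_level (S (S (2 * k))) (option_map (fun z => z ** v (rrep z)) (proj1_sig x)))) ->
  (forall z, admissible (S (S (2 * k))) (Some z) -> z ** v (rrep z) ~H z) ->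
  hJ x = k -> rep_image k f (rrep x) = rrep x ** v (rrep x).
Proof.
  intros F1 F2 Hx. apply admissible_rep in Hx as Hq. unfold rep_image.
  rewrite F1, (to_level_val _ (Some (rrep x))) by exact Hq. simpl.
  destruct (admissible_mulr_H k _ _ Hq (F2 _ Hq)) as [A _]. rewrite to_level_val by exact A.
  now rewrite rrep_idem.
Qed.

(** [psi] is well defined: x is a right multiple of its representative, so s x is determined by the
    value of s there. *)
Lemma psi_in (k : nat) f (lam : N -> Prop) (x s : N) : is_Rclass Sg lam -> lam x -> hJ x = k ->
  s ** rrep x = rep_image k f (rrep x) -> psi k f lam x = s ** x.
Proof.
  intros Hl Hx Hk Hs. unfold psi. destruct (dec _) as [_|H]; [|tauto].
  set (P := fun s => s ** rrep x = rep_image k f (rrep x)).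
  assert (HP : P (epsilon (inhabits I) P)) by (apply epsilon_spec; now exists s).
  unfold P in HP at 1. rewrite <- Hs in HP.
  fold P. rewrite <- (of_repE x) at 1 2. rewrite !mulIA. now rewrite HP.
Qed.

Lemma psi_out (k : nat) f (lam : N -> Prop) (x : N) :
  ~ (is_Rclass Sg lam /\ lam x /\ hJ x = k) -> psi k f lam x = x.
Proof. intro H. unfold psi. now destruct (dec _). Qed.

Lemma GroupPart_rep (k : nat) f (x : N) : GroupPart (S (S (2 * k))) f -> hJ x = k ->
  exists s, s ** rrep x = rep_image k f (rrep x) /\ s ** rrep x ~H rrep x.
Proof.
  intros [v [L [F1 [F2 _]]]] Hx. rewrite (rep_image_eq k f v x F1 F2 Hx).
  pose proof (F2 _ (admissible_rep k x Hx)) as H. rewrite rrep_idem in H.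
  destruct (proj1 (proj1 H)) as [s Hs]. exists s. now rewrite <- Hs.
Qed.

Lemma psi_GR (k : nat) f (lam : N -> Prop) (x : N) : GroupPart (S (S (2 * k))) f ->
  is_Rclass Sg lam -> lam x -> hJ x = k -> GR Sg lam (psi k f lam).
Proof.
  intros Hf Hl Hx Hk. destruct (GroupPart_rep k f x Hf Hk) as [s [Hs HH]].
  assert (Hin : forall z, lam z -> psi k f lam z = s ** z).
  { intros z Hz. pose proof (is_Rclass_Req lam x z Hl Hx Hz) as HR.
    apply psi_in; auto; [rewrite <- Hk; now apply Req_hJ|].
    now rewrite (rrep_eq z x HR). }
  apply (GR_intro lam _ x s); auto.
  - apply (mull_H s (rrep x)); [exact HH | apply Req_sym, rrepP].
  - intros z Hz. apply psi_out. tauto.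
Qed.

Lemma U_hJ (k : nat) (x : N) :
  U2 Sg Y iota k x \/ U3 Sg k x \/ U4 Sg Y iota k x -> hJ x = k.
Proof. intros [[_ [H _]]|[[_ [H _]]|[_ [H _]]]]; now apply is_hJ_hJ. Qed.

Lemma G_nontriv_U (k : nat) (x : N) : hJ x = k -> G_nontriv Sg x ->
  U2 Sg Y iota k x \/ U3 Sg k x \/ U4 Sg Y iota k x.
Proof.
  intros Hk HG. pose proof (hJP x) as HP. rewrite Hk in HP. unfold U2, U3.
  destruct (classic (inW Sg x)); tauto.
Qed.

(** A nontrivial group already puts the R-class into U2 or U3, so classes outside [Lambda] have
    trivial groups. *)
Lemma GR_not_Lambda (k : nat) (lam : N -> Prop) (x : N) (g : N -> N) :
  is_Rclass Sg lam -> lam x -> hJ x = k -> ~ Lambda Sg Y iota k lam -> GR Sg lam g ->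
  g = (fun z => z).
Proof.
  intros Hl Hx Hk Hn Hg. apply NNPP. intro Hne. apply Hn. split; [exact Hl|].
  intros z Hz. apply G_nontriv_U.
  - rewrite <- Hk. apply Req_hJ. now apply (is_Rclass_Req lam).
  - exists g, (fun z => z). rewrite <- (Rclass_ext lam z Hl Hz).
    split; [exact Hg|]. split; [exact (proj1 (proj2 (GR_group lam Hl))) | exact Hne].
Qed.

Lemma psi_dsum (k : nat) f : GroupPart (S (S (2 * k))) f ->
  in_dsum Sg (Lambda Sg Y iota k) (GR Sg) (psi k f).
Proof.
  intro Hf. split; [|split].
  - intros lam [Hl Hu]. pose proof Hl as [m Hm].
    assert (Hlm : lam m) by apply Hm, Req_refl.
    apply (psi_GR k f lam m); auto. now apply U_hJ, Hu.
  - intros lam Hn. destruct (classic (exists x, is_Rclass Sg lam /\ lam x /\ hJ x = k)) as [[x [Hl [Hx Hk]]]|Hno].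
    + apply (GR_not_Lambda k lam x); auto. now apply (psi_GR k f lam x).
    + apply functional_extensionality. intro x. apply psi_out. intro H. apply Hno. now exists x.
  (* Off L the multiplier is I; the representative is then fixed, and with it the whole R-class. *)
  - pose proof Hf as [v [L [F1 [F2 F3]]]]. exists (map (Rclass Sg) L). intros lam Hne.
    destruct (classic (exists x, is_Rclass Sg lam /\ lam x /\ hJ x = k /\ In (rrep x) L)) as [[x [Hl [Hx [Hk HL]]]]|Hno].
    + apply in_map_iff. exists (rrep x). split; [|exact HL]. symmetry.
      apply Rclass_ext; [exact Hl|]. apply (is_Rclass_R lam x); auto. apply rrepP.
    + exfalso. apply Hne. apply functional_extensionality. intro x.
      destruct (classic (is_Rclass Sg lam /\ lam x /\ hJ x = k)) as [[Hl [Hx Hk]]|H]; [|now apply psi_out].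
      change x with (I ** x) at 2. apply psi_in; auto.
      rewrite (rep_image_eq k f v x F1 F2 Hk), F3, mulI1; [reflexivity|apply rrep_idem|].
      intro HL. apply Hno. now exists x.
Qed.

Lemma is_Rclass_Rclass (x : N) : is_Rclass Sg (Rclass Sg x).
Proof. exists x. intro z. reflexivity. Qed.

(** [psi] reveals the image r v of each representative r, and this determines z v for all z in the
    H-class of r. *)
Lemma psi_inj (k : nat) f f' : GroupPart (S (S (2 * k))) f -> GroupPart (S (S (2 * k))) f' ->
  psi k f = psi k f' -> f = f'.
Proof.
  intros Hf Hf' Ep.
  assert (Hr : forall x, hJ x = k -> rep_image k f (rrep x) = rep_image k f' (rrep x)).
  { intros x Hk. destruct (GroupPart_rep k f x Hf Hk) as [s [Hs _]], (GroupPart_rep k f' x Hf' Hk) as [s' [Hs' _]].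
    rewrite <- Hs, <- Hs'. rewrite <- rrep_idem in Hs, Hs' |- *.
    rewrite <- (psi_in k f (Rclass Sg x) (rrep (rrep x)) s), <- (psi_in k f' (Rclass Sg x) (rrep (rrep x)) s');
      rewrite ?rrep_idem in *; rewrite ?hJ_rrep; auto using is_Rclass_Rclass; try apply rrepP.
    now rewrite Ep. }
  destruct Hf as [v [L [F1 [F2 _]]]], Hf' as [v' [L' [F1' [F2' _]]]].
  apply functional_extensionality. intros [[z|] q]; rewrite F1, F1'; f_equal; f_equal; simpl.
  f_equal. apply admissible_even in q as [Hk [Hz _]].
  specialize (Hr z Hk). rewrite (rep_image_eq k f v), (rep_image_eq k f' v') in Hr by auto.
  apply (L_mul_eq (rrep z)); [apply Hz | exact Hr].
Qed.

(** If f and g act at r by r v = s r and r w = s' r, then f followed by g gives r v w = s r w = s s'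
    r. Passing from right to left multipliers reverses the order of application, as the formula
    requires. *)
Lemma psi_comp (k : nat) f g : GroupPart (S (S (2 * k))) f -> GroupPart (S (S (2 * k))) g ->
  psi k (pcomp _ f g) = (fun lam x => psi k f lam (psi k g lam x)).
Proof.
  intros Hf Hg. apply functional_extensionality. intro lam. apply functional_extensionality.
  intro x.
  destruct (classic (is_Rclass Sg lam /\ lam x /\ hJ x = k)) as [[Hl [Hx Hk]]|H].
  2:{ now rewrite !psi_out by (rewrite ?psi_out by exact H; exact H). }
  destruct (GroupPart_rep k f x Hf Hk) as [s [Hs HH]], (GroupPart_rep k g x Hg Hk) as [s' [Hs' HH']].
  assert (HR : s' ** x ~R x).
  { apply (mull_H s' (rrep x)); [exact HH' | apply Req_sym, rrepP]. }
  rewrite (psi_in k g lam x s'), (psi_in k f lam (s' ** x) s); auto.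
  - rewrite mulIA. apply psi_in; auto.
    pose proof Hf as [v [L [F1 [F2 _]]]]. pose proof Hg as [w [L' [G1 [G2 _]]]].
    pose proof (GroupPart_comp k f g Hf Hg) as Hfg.
    unfold rep_image, pcomp. rewrite F1, G1.
    rewrite (to_level_val _ (Some (rrep x))) by now apply admissible_rep.
    simpl option_map. rewrite rrep_idem.
    pose proof (F2 _ (admissible_rep k x Hk)) as HF. rewrite rrep_idem in HF.
    destruct (admissible_mulr_H k _ _ (admissible_rep k x Hk) HF) as [A B].
    rewrite (to_level_val _ (Some (rrep x ** v (rrep x)))) by exact A. simpl option_map.
    rewrite B, rrep_idem.
    destruct (admissible_mulr_H k _ _ A (G2 _ A)) as [C _]. rewrite B, rrep_idem in C.
    rewrite to_level_val by exact C. simpl.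
    rewrite (rep_image_eq k f v) in Hs by auto. rewrite (rep_image_eq k g w) in Hs' by auto.
    rewrite <- Hs, <- !mulIA. now rewrite Hs'.
  - now apply (is_Rclass_R lam x).
  - rewrite <- Hk. now apply Req_hJ.
  - now rewrite (rrep_eq _ _ HR).
Qed.

(** A left translation by s in the group keeps s r in the R-class of the representative r, so s r =
    r v for some v. Setting v r = I where D is trivial keeps the support finite. *)
Lemma psi_surj (k : nat) (D : (N -> Prop) -> N -> N) :
  in_dsum Sg (Lambda Sg Y iota k) (GR Sg) D ->
  exists f, GroupPart (S (S (2 * k))) f /\ psi k f = D.
Proof.
  intros [D1 [D2 [l Hl]]].
  set (P := fun r v => r ** v = D (Rclass Sg r) r).
  set (v := fun r => match dec (hJ r = k /\ D (Rclass Sg r) <> (fun x => x)) with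
     | left _ => epsilon (inhabits I) (P r) | right _ => I end).
  assert (Hv : forall r, hJ r = k -> r ** v r = D (Rclass Sg r) r /\ r ** v r ~H r).
  { intros r Hk. unfold v. destruct (dec _) as [[_ Hne]|Heq].
    - assert (HL : Lambda Sg Y iota k (Rclass Sg r)) by (apply NNPP; intro H; now apply D2 in H).
      destruct (GR_elim _ _ (is_Rclass_Rclass r) (D1 _ HL)) as [_ [s [_ [Hs _]]]].
      destruct (Hs r (Req_refl r)) as [HH Ed].
      assert (HP : P r (epsilon (inhabits I) (P r))).
      { apply epsilon_spec. unfold P. rewrite Ed. destruct (proj1 (proj2 HH)) as [u Hu]. now exists u. }
      split; [exact HP|]. unfold P in HP at 1. rewrite HP, Ed. exact HH.
    - rewrite mulI1. split; [|apply Heq_refl].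
      destruct (classic (D (Rclass Sg r) = (fun x => x))) as [-> |H]; [reflexivity|tauto]. }
  assert (F2 : forall z, admissible (S (S (2 * k))) (Some z) -> z ** v (rrep z) ~H z).
  { intros z Hz. apply admissible_even in Hz as [Hk Hz].
    destruct (Hv (rrep z)) as [_ HH]; [now rewrite hJ_rrep|].
    split.
    - eapply Leq_trans; [apply Leq_mulr, Hz|]. eapply Leq_trans; [apply HH|]. apply Leq_sym, Hz.
    - apply (Req_mulr_L (rrep z)); [apply Hz | apply HH]. }
  set (f := fun x : level (S (S (2 * k))) =>
    Some (to_level (S (S (2 * k))) (option_map (fun z => z ** v (rrep z)) (proj1_sig x)))).
  exists f. assert (Hg : GroupPart (S (S (2 * k))) f).
  { exists v, (map (fun lam => rrep (epsilon (inhabits I) lam)) l).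
    split; [reflexivity|]. split; [exact F2|].
    intros r Er Hr. unfold v. destruct (dec _) as [[Hk Hne]|]; [|reflexivity].
    exfalso. apply Hr. apply in_map_iff. exists (Rclass Sg r). split; [|now apply Hl].
    rewrite <- Er at 2. apply rrep_eq.
    apply (epsilon_spec (inhabits I) (Rclass Sg r)). exists r. apply Req_refl. }
  split; [exact Hg|].
  apply functional_extensionality. intro lam. apply functional_extensionality. intro x.
  destruct (classic (is_Rclass Sg lam /\ lam x /\ hJ x = k)) as [[HL [Hx Hk]]|H].
  - destruct (GroupPart_rep k f x Hg Hk) as [s [Hs _]].
    rewrite (psi_in k f lam x s HL Hx Hk Hs).
    rewrite (rep_image_eq k f v x (fun _ => eq_refl) F2 Hk) in Hs.
    assert (Hlr : lam (rrep x)) by (apply (is_Rclass_R lam x); auto; apply rrepP).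
    destruct (Hv (rrep x)) as [Ev _]; [now rewrite hJ_rrep|].
    rewrite <- (Rclass_ext lam _ HL Hlr) in Ev. rewrite Ev in Hs. clear Ev.
    assert (HG : GR Sg lam (D lam)).
    { destruct (classic (Lambda Sg Y iota k lam)) as [HLam|HLam]; [auto|].
      rewrite D2 by exact HLam. exact (proj1 (proj2 (GR_group lam HL))). }
    destruct (GR_elim _ _ HL HG) as [_ [s' [_ [Hs' _]]]].
    rewrite (proj2 (Hs' x Hx)). rewrite (proj2 (Hs' _ Hlr)) in Hs.
    rewrite <- (of_repE x). rewrite !mulIA. now rewrite Hs.
  - rewrite psi_out by exact H.
    destruct (classic (Lambda Sg Y iota k lam)) as [HLam|HLam]; [|now rewrite D2].
    destruct (GR_elim _ _ (proj1 HLam) (D1 _ HLam)) as [_ [s' [_ [_ Ho]]]].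
    symmetry. apply Ho. intro Hx. apply H. split; [apply HLam|]. split; [exact Hx|].
    now apply U_hJ, HLam.
Qed.

End Holonomy.

Theorem theorem8p21 (Sg : semigroup) (Y : Type) (iota : Y -> car Sg)
  (HY : Y_generates Sg Y iota) (HJ : finite_J_above Sg) :
  exists (X : nat -> Type) (Mi : forall i, (X i -> option (X i)) -> Prop)
         (phi : list (MI Sg) -> seqmap X),
    (* nonempty sets X_i and monoids M_i <= P(X_i), 1 <= i <= delta *)
    (forall i, in_range Sg i -> inhabited (X i) /\ submonoidP (X i) (Mi i)) /\
    (* phi maps Rh_Y(M^I) into the wreath product *)
    (forall s, inRhY Sg Y iota s -> in_wreath X (in_range Sg) Mi (phi s)) /\
    (* phi is a monoid homomorphism *)
    (forall i (t : tup X i), in_range Sg i -> phi (rh_one Sg) i t = Some t) /\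
    (forall s s', inRhY Sg Y iota s -> inRhY Sg Y iota s' ->
       forall i (t : tup X i), in_range Sg i ->
         phi (rh_mul Sg s s') i t = sq_comp X (phi s) (phi s') i t) /\
    (* phi is injective *)
    (forall s s', inRhY Sg Y iota s -> inRhY Sg Y iota s' ->
       (forall i (t : tup X i), in_range Sg i -> phi s i t = phi s' i t) -> s = s') /\
    (* (i) *)
    (forall k, in_range Sg (S (2 * k)) ->
       forall f, Mi (S (2 * k)) f -> f = pid (X (S (2 * k))) \/ isK (X (S (2 * k))) f) /\
    (* (ii) *)
    (forall k, in_range Sg (S (S (2 * k))) ->
       (forall f, Mi (S (S (2 * k))) f ->
          isPerm (X (S (S (2 * k)))) f \/ isK (X (S (S (2 * k)))) f) /\
       exists (G' : (MI Sg -> Prop) -> (MI Sg -> MI Sg) -> Prop)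
              (psi : (X (S (S (2 * k))) -> option (X (S (S (2 * k))))) ->
                     (MI Sg -> Prop) -> MI Sg -> MI Sg),
         (forall lam, Lambda Sg Y iota k lam -> is_subgroup Sg lam (G' lam)) /\
         dsum_iso Sg (X (S (S (2 * k))))
           (fun f => Mi (S (S (2 * k))) f /\ isPerm (X (S (S (2 * k)))) f)
           (in_dsum Sg (Lambda Sg Y iota k) G') psi) /\
    (* (iii) Zeiger property *)
    (forall s, inRhY Sg Y iota s ->
       forall k (t : tup X (S (2 * k))),
         isPerm (X (S (S (2 * k)))) (loc X (phi s) (S (2 * k)) t) ->
         ~ isK (X (S (S (2 * k)))) (loc X (phi s) (S (2 * k)) t) ->
         forall n (t' : tup X (n + S (2 * k))),
           1 <= n -> in_range Sg (S (n + S (2 * k))) ->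
           drop X n (S (2 * k)) t' = t ->
           restr_id (X (S (n + S (2 * k)))) (loc X (phi s) (n + S (2 * k)) t')) /\
    (* finiteness *)
    (finite_type Y -> forall i, in_range Sg i -> finite_type (X i)).
Proof.
  pose proof (inRhY_chain Sg Y iota) as Hchain.
  exists (level Sg Y iota), (Mi Sg Y iota), (phi Sg Y iota).
  repeat match goal with |- _ /\ _ => split end.
  - intros [|p] [Hi _]; [inversion Hi|]. split; [|now apply Mi_submonoid].
    constructor. exact (to_level Sg Y iota (S p) None).
  - intros s Hs. apply phi_wreath; auto.
  - intros i t _. apply phi_one.
  - intros s s' Hs Hs' i t _. apply phi_mul; auto.
  - intros s s' Hs Hs'. apply phi_inj; auto.
  - intros k _ f. apply Mi_odd.
  - intros k _. split.
    + intros f Hf. apply Mi_even in Hf as [Hf|Hf]; [left|now right].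
      now apply GroupPart_perm.
    (* Each G'_lambda is the full Schutzenberger group. *)
    + exists (GR Sg), (psi Sg Y iota k). split; [|split; [|split; [|split]]].
      * intros lam [Hl _]. now apply GR_group.
      * intros f Hf. apply psi_dsum; [exact HJ|]. now apply Mi_perm.
      * intros f f' Hf Hf'. apply psi_inj; [exact HJ | now apply Mi_perm..].
      * intros D HD. destruct (psi_surj Sg Y iota HJ k D HD) as [f [Hf Ef]].
        exists f. split; [now apply Mi_perm | exact Ef].
      * intros f g Hf Hg. apply psi_comp; [exact HJ | now apply Mi_perm..].
  - intros s Hs k t _ HK n t' Hn _ Ht. apply (phi_zeiger Sg Y iota HJ s k t); auto.
  - intros HFY i _. now apply level_finite.
Qed.
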